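(* Let $H$ be a separable Hilbert space and let $A$ be a positive self-adjoint operator in $H$ with discrete spectrum $\{\lambda_k^2\}$ ($\lambda_k>0$) and orthonormal basis of eigenvectors $\psi_k$ ($A\psi_k=\lambda_k^2\psi_k$). Suppose that a function $u:\mathbb{R}^+\to H$ solves the equation $$u_{tt}=-Au-\alpha(t)$$ and that the following conditions are satisfied: (1) $u$ and its derivative tend to zero as $t\to\infty$: $\lim_{t\to\infty}\|u(t)\|_H=\lim_{t\to\infty}\|u_t(t)\|_H=0$; (2) the function $\alpha(t)$ belongs to $L^1(\mathbb{R}^+,H)$. Then: (i) the following representation of $u(t)$ holds: $$u(t)=\int_t^\infty A^{-\frac12}\sin\big((t-\tau)A^{\frac12}\big)\alpha(\tau)\,d\tau;$$ in particular, $$u(0)=-\int_0^\infty A^{-\frac12}\sin\big(\tau A^{\frac12}\big)\alpha(\tau)\,d\tau;$$ (ii) the coefficients $u_k$ of the Fourier series expansion $u(0)=\sum_k u_k\psi_k$ are given by $$u_k=-\lambda_k^{-1}\int_0^\infty\sin(\tau\lambda_k)\,\alpha_k(\tau)\,d\tau,\qquad \alpha_k(t)=(\alpha(t),\psi_k)_H .$$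
   Context: $\mathbb{R}^+=[0,\infty)$. Functions of the operator $A$, such as $A^{-1/2}\sin(tA^{1/2})$, are defined by the spectral functional calculus. $(\cdot,\cdot)_H$ is the scalar product of $H$, linear in the first argument. *)

(* Defs.v *)
From HB Require Import structures.
From mathcomp Require Import all_boot all_order all_algebra finmap.
From mathcomp Require Import all_classical all_reals all_analysis.
From mathcomp Require Import complex summability.

Set Implicit Arguments.
Unset Strict Implicit.
Unset Printing Implicit Defensive.

Import Order.TTheory GRing.Theory Num.Theory.
Import numFieldNormedType.Exports.

Local Open Scope classical_set_scope.
Local Open Scope ring_scope.
Local Open Scope complex_scope.

Definition Rplus {R : realType} : set R := `[0, +oo[.

(* The norm of a normed space over R[i] is R[i]-valued; this is the same
   number, as an element of R. *)
Definition rnorm {R : realType} {V : normedModType R[i]} (x : V) : R :=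
  complex.Re `|x|.

Section Calculus.
Context {R : realType} {V : normedModType R[i]}.

(* f'(t) = l for a function f on R^+: only the points of R^+ are used, so
   that the derivative is one-sided at t = 0. *)
Definition has_deriv_on_Rplus (f : R -> V) (t : R) (l : V) : Prop :=
  ((s - t)^-1)%:C *: (f s - f t) @[s --> within Rplus t^'] --> l.

Definition abs_continuous_on (a b : R) (f : R -> V) : Prop :=
  forall e : R, 0 < e -> exists2 d : R, 0 < d &
    forall s : seq (R * R),
      all (fun p => [&& a <= p.1, p.1 <= p.2 & p.2 <= b]) s ->
      pairwise (fun p q => (p.2 <= q.1) || (q.2 <= p.1)) s ->
      \sum_(p <- s) (p.2 - p.1) < d ->
      \sum_(p <- s) rnorm (f p.2 - f p.1) < e.

End Calculus.

(* Bochner integral with respect to Lebesgue measure.  A step function is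
   given by the list of pairs (E, v) standing for \sum 1_E v; the value of its
   integral does not depend on the chosen list. *)
Section Bochner.
Context {R : realType} {V : normedModType R[i]}.

Definition step (s : seq (set R * V)) (x : R) : V :=
  \sum_(p <- s) (\1_(p.1) x)%:C *: p.2.

Definition step_on (D : set R) (s : seq (set R * V)) : Prop :=
  forall p, p \in s ->
    [/\ measurable p.1, p.1 `<=` D & (lebesgue_measure p.1 < +oo)%E].

Definition step_integral (s : seq (set R * V)) : V :=
  \sum_(p <- s) (fine (lebesgue_measure p.1))%:C *: p.2.

Definition step_approx (D : set R) (f : R -> V)
    (s : nat -> seq (set R * V)) : Prop :=
  [/\ forall n, step_on D (s n),
      {ae lebesgue_measure, forall x, D x -> step (s n) x @[n --> \oo] --> f x}
    & (\int[lebesgue_measure]_(x in D) (rnorm (f x - step (s n) x))%:E)%E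
        @[n --> \oo] --> 0%E].

(* f belongs to L^1(D, V). *)
Definition bochner_integrable (D : set R) (f : R -> V) : Prop :=
  exists s, step_approx D f s.

Definition is_bochner_integral (D : set R) (f : R -> V) (v : V) : Prop :=
  exists2 s, step_approx D f s & step_integral (s n) @[n --> \oo] --> v.

(* The default value 0 is used only when f is not integrable or V is not
   complete. *)
Definition bochner_integral (D : set R) (f : R -> V) : V :=
  xget 0 [set v | is_bochner_integral D f v].

End Bochner.

Record unbounded_op {R : realType} (H : lmodType R[i]) := UnboundedOp {
  dom : set H;
  op_fun :> H -> H;
  dom0 : dom 0;
  dom_linear : forall a x y, dom x -> dom y -> dom (a *: x + y);
  op_linear : forall a x y, dom x -> dom y ->
    op_fun (a *: x + y) = a *: op_fun x + op_fun y }.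

Section Operators.
Context {R : realType} {H : completeNormedModType R[i]}.
Variable dot : {dot H for @Num.conj R[i]}.
Variable A : unbounded_op H.

(* y is in the domain of the adjoint A^* and A^* y = z (when dom A is dense) *)
Definition adjoint_graph (y z : H) : Prop :=
  forall x, dom A x -> dot (A x) y = dot x z.

Definition self_adjoint : Prop :=
  dense (dom A) /\
  forall y z, adjoint_graph y z <-> dom A y /\ A y = z.

Definition positive_op : Prop := forall x, dom A x -> 0 <= dot (A x) x.

Definition resolvent_set : set R[i] :=
  [set z | exists S : {linear H -> H},
     [/\ continuous S,
         forall y, dom A (S y) /\ A (S y) - z *: S y = y
       & forall x, dom A x -> S (A x - z *: x) = x] ].

Definition spectrum : set R[i] := ~` resolvent_set.

Definition eigenspace_op (z : R[i]) : set H :=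
  [set x | dom A x /\ A x = z *: x].

Definition finite_dimensional (E : set H) : Prop :=
  exists n (e : 'I_n -> H),
    forall x, E x -> exists c : 'I_n -> R[i], x = \sum_(i < n) c i *: e i.

(* The spectrum consists of isolated eigenvalues of finite multiplicity. *)
Definition discrete_spectrum : Prop :=
  forall z : R[i], spectrum z ->
    [/\ @isolated R[i]^o spectrum z,
        exists2 x, eigenspace_op z x & x != 0
      & finite_dimensional (eigenspace_op z)].

(* Orthogonal projection onto the eigenspace of mu (0 when mu is not an
   eigenvalue), i.e. the spectral projection E({mu}) of A. *)
Definition eigenproj (mu : R) (x : H) : H :=
  xget 0 [set y | eigenspace_op mu%:C y /\
                  forall z, eigenspace_op mu%:C z -> dot (x - y) z = 0].

(* f(A) x, where f(A) is the integral of f against the spectral measure of A.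
   The spectrum of A being discrete, this measure is concentrated on the
   eigenvalues, E(B) = \sum_(mu in B) E({mu}), and the integral is the
   unconditional sum of f(mu) E({mu}) x over all real mu. *)
Definition functional_calculus (f : R -> R[i]) (x : H) : H :=
  summability.sum (fun mu : R => f mu *: eigenproj mu x).

(* u_tt = - A u - alpha on R^+, where ut is the derivative of u.  As alpha is
   an L^1 function, the equation holds almost everywhere; ut is then required
   to be locally absolutely continuous, tested against the elements of dom A.
   A classical solution, for which the equation holds at every t >= 0, is a
   special case: (ut(t), phi) then has the finite, locally integrable
   derivative -(u(t), A phi) - (alpha(t), phi) at every point, hence is
   locally absolutely continuous. *)
Record wave_solution (u ut alpha : R -> H) : Prop := WaveSolution {
  wave_deriv : forall t, Rplus t -> has_deriv_on_Rplus u t (ut t);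
  wave_abs_continuous : forall phi, dom A phi -> forall T : R, 0 < T ->
    abs_continuous_on 0 T (fun t => dot (ut t) phi : R[i]^o);
  wave_equation : {ae lebesgue_measure, forall t, Rplus t ->
    dom A (u t) /\ has_deriv_on_Rplus ut t (- A (u t) - alpha t)} }.

End Operators.

Definition orthonormal_basis {R : realType} {H : completeNormedModType R[i]}
    (dot : {dot H for @Num.conj R[i]}) (I : countType) (psi : I -> H) : Prop :=
  (forall i j, dot (psi i) (psi j) = (i == j)%:R) /\
  dense [set x | exists (s : seq I) (c : I -> R[i]),
                   x = \sum_(i <- s) c i *: psi i].

(* The function s |-> s^(-1/2) sin (t s^(1/2)), whose value at A is the
   operator A^(-1/2) sin (t A^(1/2)). *)
Definition sin_sqrt {R : realType} (t : R) (s : R) : R[i] :=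
  ((Num.sqrt s)^-1 * sin (t * Num.sqrt s))%:C.

(* Main.v *)
Require Import Defs.
From HB Require Import structures.
From mathcomp Require Import all_boot all_order all_algebra finmap.
From mathcomp Require Import all_classical all_reals all_analysis.
From mathcomp Require Import complex summability.
From mathcomp Require Import measurable_realfun ring lra.

Set Implicit Arguments.
Unset Strict Implicit.
Unset Printing Implicit Defensive.

Import Order.TTheory GRing.Theory Num.Theory.
Import numFieldNormedType.Exports.

Local Open Scope classical_set_scope.
Local Open Scope ring_scope.
Local Open Scope complex_scope.

(** Pairing u_tt = - A u - alpha with psi_k gives, for v = (u, psi_k),
    a = (alpha, psi_k) and l = lambda_k, the scalar equation v'' = - l^2 v - a.
    For fixed t the function
      F(x) = v'(x) sin((t - x) l) / l + v(x) cos((t - x) l)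
    is locally absolutely continuous, F(t) = v(t), F tends to 0 at infinity and
    F'(x) = - a(x) sin((t - x) l) / l almost everywhere; integrating F' over
    [t, +oo[ gives the coefficients of the claimed representation of u(t).
    As 0 is not in the spectrum, A has a bounded inverse, so the lambda_k are
    bounded away from 0; the integrand of (i) is then dominated by a multiple of
    |alpha|, hence Bochner integrable, and its integral is determined by its
    coefficients. *)

(** F(x) is the value at time t of the solution of the source-free equation with Cauchy data (v(x),
    v'(x)) at time x. It is therefore constant in x when a = 0, and in general its derivative
    retains only the source. As v' is differentiable only almost everywhere, integrating F' is the
    fundamental theorem for absolutely continuous functions: F minus the indefinite integral of F'
    is shown to be constant by continuous induction along the interval, the null set of bad points
    being hidden in an open set of small measure. Two obstacles shape the vector-valued part. First,
    alpha is an almost everywhere limit of step functions, so its coefficients are known to be Borel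
    measurable only off a null set N; integrals are moved to the complement of N by lemmas that hold
    for arbitrary integrands. Second, Bochner integrability asks for step functions: they are built
    by rounding finitely many coordinates, and their convergence is controlled by the comparison
    principle [rnorm_dominated]. The same principle produces vectors with prescribed coefficients
    and the convergence of the functional calculus. *)

Local Notation mu := lebesgue_measure.

(** * Absolutely continuous functions *)

Definition itv_family {R : realType} (a b : R) (s : seq (R * R)) :=
  all (fun p => [&& a <= p.1, p.1 <= p.2 & p.2 <= b]) s &&
  pairwise (fun p q => (p.2 <= q.1) || (q.2 <= p.1)) s.

(** Real-valued counterpart of [abs_continuous_on], meant for the real and imaginary parts of
    Fourier coefficients. *)
Definition ac_on {R : realType} (a b : R) (f : R -> R) :=
  forall e, 0 < e -> exists2 d, 0 < d & forall s, itv_family a b s ->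
    \sum_(p <- s) (p.2 - p.1) < d -> \sum_(p <- s) `|f p.2 - f p.1| < e.

(* Continuous induction on the right end of [a, x]. *)
Lemma cousin_bound {R : realType} (f : R -> R) (a b M : R) (U : set R) :
  a <= b -> 0 <= M ->
  (forall t, a <= t <= b -> exists2 d, 0 < d &
     (forall s, a <= s <= b -> `|s - t| < d -> `|f s - f t| <= M * `|s - t|) \/
     (forall s, `|s - t| < d -> U s)) ->
  exists s, [/\ itv_family a b s,
    forall p, p \in s -> `[p.1, p.2] `<=` U &
    `|f b - f a| <= M * (b - a) + \sum_(p <- s) `|f p.2 - f p.1|].
Proof.
move=> ab M0 loc.
pose good x := a <= x <= b /\ exists s, [/\ itv_family a x s,
    forall p, p \in s -> `[p.1, p.2] `<=` U &
    `|f x - f a| <= M * (x - a) + \sum_(p <- s) `|f p.2 - f p.1|].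
have good_step x y : good x -> x <= y <= b ->
    `|f y - f x| <= M * (y - x) \/ `[x, y] `<=` U -> good y.
  move=> [/andP[ax xb] [s [/andP[sx sp] sU fx]]] /andP[xy yb] H; split.
    by rewrite (le_trans ax xy).
  case: H => H.
    exists s; split => //.
      apply/andP; split => //; apply: sub_all sx => p /and3P[-> -> pb] /=.
      exact: le_trans pb xy.
    have -> : f y - f a = (f y - f x) + (f x - f a) by ring.
    rewrite (le_trans (ler_normD _ _))// (le_trans (lerD H fx))//.
    by rewrite addrA -mulrDr; lra.
  exists ((x, y) :: s); split => //.
  - apply/andP; split => /=.
      rewrite ax xy lexx /=; apply: sub_all sx => p /and3P[-> -> pb] /=.
      exact: le_trans pb xy.
    rewrite sp andbT; apply/allP => p ps; move/allP: sx => /(_ _ ps) /and3P[_ _ ->].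
    by rewrite orbT.
  - by move=> p; rewrite inE => /orP[/eqP ->|/sU].
  - rewrite big_cons /=.
    have -> : f y - f a = (f y - f x) + (f x - f a) by ring.
    rewrite (le_trans (ler_normD _ _))// addrCA lerD2l (le_trans fx)// lerD2r.
    by apply: ler_wpM2l => //; lra.
have good_a : good a.
  split; first by rewrite lexx.
  by exists [::]; rewrite big_nil !subrr normr0 mulr0 addr0.
have sG : has_sup [set x | good x].
  split; first by exists a.
  by exists b => x [/andP[]].
set c := sup [set x | good x].
have cub x : good x -> x <= c by move=> gx; exact: sup_ubound (sG.2) _ gx.
have cab : a <= c <= b.
  rewrite cub//= ge_sup//; first by exists a.
  by move=> x [/andP[]].
have [d d0 Hd] := loc _ cab.
have [x gx xc] : exists2 x, good x & c - d < x.
  have := sup_adherent d0 sG; by move=> [x /= gx ?]; exists x.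
(* The local hypothesis compares points with its centre c only, so the passage from x to y is made
   in two steps, through c. *)
have key y : c <= y -> y <= b -> y < c + d -> good y.
  move=> cy yb yd; have xc' := cub _ gx.
  have [/andP[ax xb] _] := gx; case/andP: (cab) => ac cb.
  have gc : good c.
    apply: good_step gx _ _; first by rewrite xc'.
    case: Hd => Hd; [left|right].
      have := Hd x; rewrite ax xb ler0_norm ?subr_le0// opprB => /(_ isT).
      by rewrite distrC => H; apply: H; lra.
    move=> z /=; rewrite in_itv /= => /andP[xz zc]; apply: Hd.
    by rewrite ler0_norm ?subr_le0//; lra.
  apply: good_step gc _ _; first by rewrite cy.
  case: Hd => Hd; [left|right].
    have := Hd y; rewrite (le_trans ac cy) yb ger0_norm ?subr_ge0// => H.
    by apply: H => //; lra.
  move=> z /=; rewrite in_itv /= => /andP[xz zc]; apply: Hd.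
  by rewrite ger0_norm ?subr_ge0//; lra.
have [cb|cb] : c = b \/ c < b.
  by case/andP: cab => _; rewrite le_eqVlt => /orP[/eqP|]; [left|right].
  have cb1 : c <= b by rewrite cb.
  have cb2 : b < c + d by rewrite cb ltrDl.
  by have [_ [s ?]] := key b cb1 (lexx _) cb2; exists s.
(* If c < b, this is a good point strictly beyond the supremum c. *)
pose y := Num.min b (c + d / 2).
have cy : c < y by rewrite lt_min cb /=; lra.
have := key y (ltW cy); rewrite ge_min lexx /= gt_min => /(_ isT).
have -> : c + d / 2 < c + d by lra.
by rewrite orbT => /(_ isT) /cub; rewrite leNgt cy.
Qed.

Section itv_union.
Context {R : realType}.
Notation mu := (@lebesgue_measure R).

(** Half-open intervals, so that members of a family sharing an endpoint are disjoint and the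
    integral is exactly additive. *)
Definition itv_union (s : seq (R * R)) : set R :=
  \big[setU/set0]_(p <- s) `]p.1, p.2]%classic.

Lemma itv_union_measurable s : measurable (itv_union s).
Proof. by apply: bigsetU_measurable => p _; exact: measurable_itv. Qed.

Lemma integral_itv_union (f : R -> \bar R) a b s : measurable_fun setT f ->
  (forall x, 0 <= f x)%E -> itv_family a b s ->
  (\int[mu]_(x in itv_union s) f x =
   \sum_(p <- s) \int[mu]_(x in `]p.1, p.2]) f x)%E.
Proof.
move=> mf f0; elim: s => [_|p s IH]; first by rewrite /itv_union !big_nil integral_set0.
rewrite /itv_family /= => /andP[/andP[pab sab] /andP[psp sp]].
rewrite /itv_union !big_cons ge0_integral_setU//; first last.
- rewrite -bigcup_seq; apply/disj_setPRL => x /= [q /= qs].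
  move/allP: psp => /(_ _ qs) /= H; rewrite !in_itv/= => /andP[q1 q2] /andP[p1 p2].
  case/orP: H => H; first by have := lt_le_trans q1 p2; rewrite ltNge H.
  by have := lt_le_trans p1 q2; rewrite ltNge H.
- exact: measurable_funS mf.
- exact: itv_union_measurable.
by rewrite -/(itv_union s) IH// /itv_family sab.
Qed.

Lemma measure_itv_union a b s : itv_family a b s ->
  mu (itv_union s) = (\sum_(p <- s) (p.2 - p.1))%:E.
Proof.
move=> sab; rewrite -[LHS]mul1e -integral_cst; last exact: itv_union_measurable.
rewrite (integral_itv_union _ _ sab)//.
rewrite -sumEFin; apply: eq_big_seq => p ps.
rewrite integral_cst//= mul1e lebesgue_measure_itv/= lte_fin.
move/andP: sab => [/allP /(_ _ ps) /and3P[_ + _] _].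
by rewrite le_eqVlt => /orP[/eqP ->|->//]; rewrite ltxx subrr.
Qed.

End itv_union.

Section ac.
Context {R : realType}.
Implicit Types (f g : R -> R) (a b : R).

Lemma itv_family1 a b x y : a <= x -> x <= y -> y <= b -> itv_family a b [:: (x, y)].
Proof. by move=> ax xy yb; rewrite /itv_family /= ax xy yb. Qed.

Lemma ac_onD a b f g : ac_on a b f -> ac_on a b g -> ac_on a b (f \+ g).
Proof.
move=> acf acg e e0; have e20 : 0 < e / 2 by lra.
have [d d0 Hd] := acf _ e20; have [d' d'0 Hd'] := acg _ e20.
exists (Num.min d d'); first by rewrite lt_min d0.
move=> s sab; rewrite lt_min => /andP[/(Hd _ sab) Hf /(Hd' _ sab) Hg].
rewrite (@le_lt_trans _ _ (\sum_(p <- s) (`|f p.2 - f p.1| + `|g p.2 - g p.1|)))//.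
  by apply: ler_sum => p _; rewrite /= opprD addrACA ler_normD.
by rewrite big_split /=; lra.
Qed.

Lemma ac_onZ a b f c : ac_on a b f -> ac_on a b (fun x => c * f x).
Proof.
move=> acf e e0; have c0 : 0 < `|c| + 1 by rewrite ltr_wpDl.
have [d d0 Hd] := acf _ (divr_gt0 e0 c0); exists d => // s sab /(Hd _ sab).
rewrite ltr_pdivlMr// mulr_suml; apply: le_lt_trans; apply: ler_sum => p _.
by rewrite -mulrBr normrM mulrC ler_wpM2l// lerDl.
Qed.

Lemma ac_onB a b f g : ac_on a b f -> ac_on a b g -> ac_on a b (f \- g).
Proof.
move=> acf acg; have -> : f \- g = f \+ (fun x => -1 * g x).
  by apply/funext => x /=; rewrite mulN1r.
by apply: ac_onD => //; exact: ac_onZ.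
Qed.

Lemma ac_onM a b f g (M : R) : ac_on a b f -> ac_on a b g ->
  (forall x, a <= x <= b -> `|f x| <= M) -> (forall x, a <= x <= b -> `|g x| <= M) ->
  ac_on a b (f \* g).
Proof.
move=> acf acg fM gM e e0; have M0 : 0 < `|M| + 1 by rewrite ltr_wpDl.
have e20 : 0 < e / 2 / (`|M| + 1) by rewrite !divr_gt0.
have [d d0 Hd] := acf _ e20; have [d' d'0 Hd'] := acg _ e20.
exists (Num.min d d'); first by rewrite lt_min d0.
move=> s sab; rewrite lt_min => /andP[/(Hd _ sab) Hf /(Hd' _ sab) Hg].
move: Hf Hg; rewrite !ltr_pdivlMr// => Hf Hg.
have MM : M <= `|M| + 1 by rewrite (le_trans (ler_norm _))// lerDl.
rewrite (@le_lt_trans _ _ (\sum_(p <- s)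
   (`|f p.2 - f p.1| * (`|M| + 1) + `|g p.2 - g p.1| * (`|M| + 1))))//.
  rewrite big_seq [leRHS]big_seq; apply: ler_sum => p ps /=.
  move/andP: sab => [/allP /(_ _ ps) /and3P[p1 p2 p3] _].
  have -> : f p.2 * g p.2 - f p.1 * g p.1 =
     (f p.2 - f p.1) * g p.2 + (g p.2 - g p.1) * f p.1 by ring.
  rewrite (le_trans (ler_normD _ _))// !normrM lerD// ler_wpM2l//.
    by rewrite (le_trans (gM _ _))// p3 (le_trans p1 p2).
  by rewrite (le_trans (fM _ _))// p1 (le_trans p2 p3).
by rewrite big_split /= -!mulr_suml; lra.
Qed.

Lemma ac_on_sub a b a' b' f : a <= a' -> b' <= b -> ac_on a b f -> ac_on a' b' f.
Proof.
move=> aa' bb' acf e /acf [d d0 Hd]; exists d => // s /andP[sab sp]; apply: Hd.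
rewrite /itv_family sp andbT; apply: sub_all sab => p /and3P[p1 -> p3] /=.
by rewrite (le_trans aa' p1) (le_trans p3 bb').
Qed.

Lemma lipschitz_ac_on a b f (M : R) : 0 <= M ->
  (forall x y, a <= x -> x <= y -> y <= b -> `|f y - f x| <= M * (y - x)) ->
  ac_on a b f.
Proof.
move=> M0 lf e e0; have M1 : 0 < M + 1 by lra.
exists (e / (M + 1)); first exact: divr_gt0.
move=> s sab; rewrite ltr_pdivlMr// mulr_suml; apply: le_lt_trans.
rewrite big_seq [leRHS]big_seq; apply: ler_sum => p ps.
move/andP: sab => [/allP /(_ _ ps) /and3P[p1 p2 p3] _].
by rewrite (le_trans (lf _ _ _ _ _))//; nra.
Qed.

(** Clamping the argument to [a, b] extends f by constants to the whole line. The clamp is monotone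
    and 1-Lipschitz, so absolute continuity on single intervals gives continuity everywhere, and the
    extreme value theorem then bounds f. *)
Lemma ac_on_continuous a b f : a <= b -> ac_on a b f ->
  continuous (fun x => f (Num.max a (Num.min x b))).
Proof.
move=> ab acf x; apply/cvgrPdist_le => e e0.
have [d d0 Hd] := acf _ e0; near=> y.
pose c z := Num.max a (Num.min z b).
have cab z : a <= c z <= b.
  by rewrite le_max lexx ge_max ab ge_min lexx orbT.
have clip u v : u <= v -> c u <= c v /\ c v - c u <= v - u.
  by move=> uv; rewrite /c /Num.max /Num.min; repeat case: ifP; lra.
have key u v : u <= v -> v - u < d -> `|f (c v) - f (c u)| < e.
  move=> uv uvd; have [cuv cuv'] := clip _ _ uv.
  have /andP[u1 _] := cab u; have /andP[_ v2] := cab v.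
  have := Hd _ (itv_family1 u1 cuv v2); rewrite !big_seq1 /=; apply; lra.
rewrite -/(c x) -/(c y).
have : `|x - y| < d by near: y; exact: cvgr_dist_lt.
have [xy|yx] := leP x y => xyd.
- by rewrite distrC ltW// key//; rewrite distrC ger0_norm ?subr_ge0// in xyd.
- by rewrite ltW// key// ?ltW//; rewrite ger0_norm ?subr_ge0// ltW in xyd.
Unshelve. all: by end_near. Qed.

Lemma ac_on_bounded a b f : a <= b -> ac_on a b f ->
  exists M, forall x, a <= x <= b -> `|f x| <= M.
Proof.
move=> ab acf; have cf := ac_on_continuous ab acf.
have cnf : {within `[a, b], continuous
    (fun x => `|f (Num.max a (Num.min x b))|)}.
  apply: continuous_subspaceT => x.
  by apply: continuous_comp; [exact: cf|exact: norm_continuous].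
have [c _ Hc] := EVT_max ab cnf.
exists (`|f (Num.max a (Num.min c b))|) => x /andP[ax xb].
by have := Hc x; rewrite in_itv/= ax xb (min_idPl xb) (max_idPr ax); apply.
Qed.

End ac.

Lemma cvg_near_eq {T : Type} {U : topologicalType} (F : set_system T)
    {FF : Filter F} (f g : T -> U) (l : U) :
  f x @[x --> F] --> l -> (\forall x \near F, f x = g x) -> g x @[x --> F] --> l.
Proof. by move=> fl fg; apply: cvg_trans fl; exact: near_eq_cvg. Qed.

(** * Real derivatives relative to the half-line *)

Section rderiv.
Context {R : realType}.
Implicit Types (f g : R -> R) (t l : R).

Definition rderiv f t l :=
  (f s - f t) / (s - t) @[s --> within Rplus t^'] --> l.

Let within_Rplus_filter t : Filter (within (@Rplus R) t^').
Proof. exact: within_filter. Qed.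
Local Existing Instance within_Rplus_filter.

Lemma within_dnbhs_neq t : \forall s \near within (@Rplus R) t^', s != t.
Proof. by rewrite near_withinE; near=> s => _; near: s; exact: nbhs_dnbhs_neq. 
Unshelve. all: by end_near. Qed.

Lemma rderivP f t l : rderiv f t l <-> forall e, 0 < e -> exists2 d, 0 < d &
  forall s, 0 <= s -> `|s - t| < d -> `|f s - f t - l * (s - t)| <= e * `|s - t|.
Proof.
split=> [/cvgrPdist_le H e e0|H].
  have /= := H _ e0; rewrite near_withinE => -[d d0 Hd]; exists d => // s s0 std.
  have [->|st] := eqVneq s t; first by rewrite !subrr normr0 !mulr0 subr0 normr0.
  have /= := Hd s; rewrite /ball_/= distrC => /(_ std st).
  rewrite /Rplus /= in_itv/= s0 => /(_ isT).
  rewrite -(ler_pM2r (x := `|s - t|)) ?normr_gt0 ?subr_eq0//.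
  by rewrite -normrM mulrBl divfK ?subr_eq0// distrC.
apply/cvgrPdist_le => e e0; have [d d0 Hd] := H _ e0.
rewrite near_withinE; exists d => //= s /= std st.
rewrite /Rplus /= in_itv/= andbT => s0.
rewrite -(ler_pM2r (x := `|s - t|)) ?normr_gt0 ?subr_eq0//.
rewrite -normrM mulrBl divfK ?subr_eq0// distrC.
by apply: Hd => //; rewrite distrC.
Qed.

Lemma rderivM f g t l m : 0 <= t -> rderiv f t l -> rderiv g t m ->
  rderiv (f \* g) t (l * g t + f t * m).
Proof.
move=> t0 df dg.
have cg : g s @[s --> within Rplus t^'] --> g t.
  have idt : s @[s --> within Rplus t^'] --> t.
    by move=> A At; apply: cvg_within; exact: nbhs_dnbhs.
  have H : (s - t) * ((g s - g t) / (s - t)) + g t @[s --> within Rplus t^'] -->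
      (t - t) * m + g t.
    by apply: cvgD; [apply: cvgM => //; apply: cvgB => //|]; exact: cvg_cst.
  rewrite subrr mul0r add0r in H; apply: (cvg_near_eq H).
  near=> s; have st : s != t by near: s; exact: within_dnbhs_neq.
  by rewrite /=; field; rewrite subr_eq0.
have H : (f s - f t) / (s - t) * g s + f t * ((g s - g t) / (s - t))
    @[s --> within Rplus t^'] --> l * g t + f t * m.
  by apply: cvgD; apply: cvgM => //; exact: cvg_cst.
apply: (cvg_near_eq H); near=> s.
have st : s != t by near: s; exact: within_dnbhs_neq.
by rewrite /=; field; rewrite subr_eq0.
Unshelve. all: by end_near. Qed.

Lemma rderivD f g t l m : rderiv f t l -> rderiv g t m ->
  rderiv (f \+ g) t (l + m).
Proof.
move=> df dg; have H : (f s - f t) / (s - t) + (g s - g t) / (s - t)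
    @[s --> within Rplus t^'] --> l + m by exact: cvgD.
apply: (cvg_near_eq H); near=> s.
by rewrite /= -mulrDl opprD addrACA.
Unshelve. all: by end_near. Qed.

Lemma rderivN f t l : rderiv f t l -> rderiv (\- f) t (- l).
Proof.
move=> df; have H : - ((f s - f t) / (s - t)) @[s --> within Rplus t^'] --> - l by exact: cvgN.
apply: (cvg_near_eq H); near=> s.
by rewrite /= -opprD mulNr.
Unshelve. all: by end_near. Qed.

Lemma is_derive_rderiv f t l : is_derive t 1 f l -> rderiv f t l.
Proof.
move=> [df dl]; apply/rderivP => e e0.
have /cvgrPdist_le : (h^-1 *: (f (h + t) - f t) @[h --> 0^'] --> l).
  by rewrite -dl; move: df; rewrite /derivable /derive;
   under eq_fun do rewrite [_%:A]mulr1.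
move=> /(_ _ e0) [d d0 Hd]; exists d => // s _ std.
have [->|st] := eqVneq s t; first by rewrite !subrr normr0 !mulr0 subr0 normr0.
have /= := Hd (s - t); rewrite /ball_/= sub0r normrN subrK subr_eq0 => /(_ std st).
rewrite -(ler_pM2r (x := `|s - t|)) ?normr_gt0 ?subr_eq0//.
by rewrite -normrM mulrBl [_ *: _]mulrC divfK ?subr_eq0// distrC.
Qed.

(** Mean value inequality from [cousin_bound] with an empty exceptional set. The extra 1 is the
    error allowed in the first-order expansion; it is harmless, since any Lipschitz constant yields
    absolute continuity. *)
Lemma rderiv_lipschitz a b f f' M : 0 <= a -> 0 <= M ->
  (forall t, a <= t <= b -> rderiv f t (f' t) /\ `|f' t| <= M) ->
  forall x y, a <= x -> x <= y -> y <= b -> `|f y - f x| <= (M + 1) * (y - x).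
Proof.
move=> a0 M0 H x y ax xy yb.
have [|t /andP[xt ty]|s [+ s0]] := @cousin_bound R f x y (M + 1) set0 xy; first by lra.
  have [|/rderivP /(_ _ ltr01) [d d0 Hd] Mt] := H t.
    by rewrite (le_trans ax xt) (le_trans ty yb).
  exists d => //; left => s /andP[xs _] std.
  have H' := Hd s (le_trans a0 (le_trans ax xs)) std.
  have -> : f s - f t = (f s - f t - f' t * (s - t)) + f' t * (s - t) by ring.
  rewrite (le_trans (ler_normD _ _))// mulrDl [leRHS]addrC lerD//.
  by rewrite normrM ler_wpM2r.
(* Every interval of the family contains its left endpoint and lies in the empty set, so the family
   is empty. *)
case: s s0 => [|p s s0]; first by rewrite big_nil addr0.
move=> /andP[/= /andP[/and3P[_ pp _] _] _]; exfalso.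
by apply: (s0 p (mem_head _ _) p.1); rewrite /= in_itv/= lexx.
Qed.

End rderiv.

(** * The fundamental theorem for absolutely continuous functions *)

Section ac_ftc.
Context {R : realType}.
Notation mu := (@lebesgue_measure R).
Variable phi : R -> R.
Hypothesis iphi : mu.-integrable setT (EFin \o phi).

Let G x := \int[mu]_(t in `]-oo, x]) phi t.

Let integrable_on (D : set R) : measurable D -> mu.-integrable D (EFin \o phi).
Proof. by move=> mD; apply: integrableS iphi. Qed.

Let GB x y : x <= y -> G y - G x = \int[mu]_(t in `]x, y]) phi t.
Proof.
move=> xy; apply: Rintegral_itvB; rewrite ?bnd_simp//.
exact: integrable_on.
Qed.

Let integrable_norm_phi : mu.-integrable setT (EFin \o (fun x => `|phi x|)).
Proof. by have := integrable_norm iphi. Qed.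

Let mnphi : measurable_fun setT (fun x => `|phi x|%:E).
Proof. by have /integrableP[] := integrable_norm_phi. Qed.

Lemma indefinite_integral_ac a b : ac_on a b G.
Proof.
move=> e e0; have [d [d0 Hd]] := integral_normr_continuous iphi e0.
exists d => // s sab sd.
have muE : (mu (itv_union s) < d%:E)%E by rewrite (measure_itv_union sab) lte_fin.
apply: le_lt_trans (Hd _ (itv_union_measurable s) muE).
rewrite /Rintegral (integral_itv_union _ _ sab)//.
rewrite (eq_big_seq (fun p => (\int[mu]_(x in `]p.1, p.2]) `|phi x|)%:E)); last first.
  move=> p _; rewrite /Rintegral fineK//; apply: integrable_fin_num => //.
  exact: integrableS integrable_norm_phi.
rewrite sumEFin /= big_seq [leRHS]big_seq; apply: ler_sum => p ps.
move/andP: sab => [/allP /(_ _ ps) /and3P[_ p12 _] _].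
by rewrite GB// le_normr_Rintegral//; exact: integrable_on.
Qed.

Lemma indefinite_integral_rderiv :
  {ae mu, forall x, rderiv G x (phi x)}.
Proof.
have iN y : mu.-integrable `]-oo, y] (EFin \o phi) by exact: (integrable_on (measurable_itv _)).
have lphi : locally_integrable [set: R] phi by apply: open_integrable_locally => //; exact: openT.
have [N [mN N0 HN]] := FTC1Ny iN lphi.
exists N; split => // x /= H; apply: HN => /= -[dG dGE]; apply: H.
apply: is_derive_rderiv; apply: DeriveDef => //.
by rewrite -derive1E.
Qed.

(** F - G is absolutely continuous and has derivative 0 off a null set N. Off N its increments are
    small by the derivative; points of N lie in an open U of small measure, over which the
    increments are small by absolute continuity. [cousin_bound] combines the two. *)
Lemma ac_ftc F a b : 0 <= a -> a <= b -> ac_on a b F ->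
  {ae mu, forall x, 0 <= x -> rderiv F x (phi x)} ->
  F b - F a = \int[mu]_(t in `]a, b]) phi t.
Proof.
move=> a0 ab acF [N1 [mN1 N10 HN1]].
have [N2 [mN2 N20 HN2]] := indefinite_integral_rderiv.
set N := N1 `|` N2.
have mN : measurable N by exact: measurableU.
have N0 : mu N = 0%E by exact: null_set_setU.
have acH : ac_on a b (F \- G) by apply: ac_onB => //; exact: indefinite_integral_ac.
apply/eqP; rewrite -GB// -subr_eq0 -normr_le0; apply/ler_addgt0Pr => e e0.
rewrite add0r.
(* With e' this quotient, the slope part contributes e' (b - a) and the intervals inside U
   contribute e', which add up to e. *)
have e1 : 0 < e / (b - a + 1) by apply: divr_gt0 => //; lra.
set e' := e / (b - a + 1) in e1 *.
have [d d0 Hd] := acH _ e1.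
have muN : (mu N < +oo)%E by rewrite N0.
have [U [oU NU Ud]] := lebesgue_regularity_outer mN muN d0.
(* Outer regularity bounds the measure of U minus N, which is that of U because N is null. *)
have muU : (mu U < d%:E)%E.
  have mU := open_measurable oU.
  have -> : mu U = (mu (U `\` N) + mu (U `&` N))%E by exact: measureDI.
  have -> : mu (U `&` N) = 0%E.
    by apply: subset_measure0 N0 => //; exact: measurableI.
  by rewrite adde0.
have [||s [sab sU]] := @cousin_bound R (F \- G) a b e' U ab; first exact: ltW.
  move=> t /andP[at_ tb]; have t0 := le_trans a0 at_.
  have [Nt|Nt] := pselect (N t).
    have [r r0 Hr] : exists2 r : R, 0 < r & ball t r `<=` U.
      by have /nbhs_ballP := open_nbhs_nbhs (conj oU (NU _ Nt)).
    by exists r => //; right => s st; apply: Hr; rewrite /ball /= distrC.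
  have dF : rderiv F t (phi t).
    by apply: contrapT => H; apply: Nt; left; apply: HN1 => /= /(_ t0).
  have dG : rderiv G t (phi t).
    by apply: contrapT => H; apply: Nt; right; apply: HN2.
  have /rderivP /(_ _ e1) [r r0 Hr] := rderivD dF (rderivN dG).
  exists r => //; left => s /andP[sa _] st.
  by have := Hr _ (le_trans a0 sa) st; rewrite subrr mul0r subr0.
have Hs : \sum_(p <- s) (p.2 - p.1) < d.
  rewrite -lte_fin -(measure_itv_union sab); apply: le_lt_trans muU.
  apply: le_measure; rewrite ?inE//; [exact: itv_union_measurable|exact: open_measurable|].
  rewrite /itv_union -bigcup_seq => x [p /= /sU pU] xp; apply: pU.
  by move: xp; rewrite /= !in_itv/= => /andP[/ltW -> ->].
have {Hs}Hs := Hd _ sab Hs.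
have -> : F b - F a - (G b - G a) = (F b - G b) - (F a - G a) by ring.
move=> /le_trans; apply.
rewrite (_ : e = e' * (b - a) + e'); last first.
  by rewrite /e'; field; lra.
by rewrite lerD2l ltW.
Qed.

End ac_ftc.

(** * The scalar equation *)

Lemma truncnS_le {R : realType} (x : R) n : ((Num.truncn x).+1 <= n)%N -> x <= n%:R.
Proof. by move=> xn; rewrite (le_trans (ltW (truncnS_gt x)))// ler_nat. Qed.

Lemma cvgry_addn {R : realType} (t : R) : t + n%:R @[n --> \oo] --> +oo.
Proof.
apply/cvgryPge => M; exists (Num.truncn (M - t)).+1 => //= n /= Mn.
by rewrite -lerBlDl; exact: truncnS_le.
Qed.

(** Dominated convergence for the restrictions of phi, with |phi| as bound. The half-open intervals
    are those of [ac_ftc]; the point t is added at no cost. *)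
Lemma cvg_integral_tail {R : realType} (phi : R -> R) (t : R) :
  (@lebesgue_measure R).-integrable setT (EFin \o phi) ->
  \int[lebesgue_measure]_(x in `]t, t + n%:R]) phi x @[n --> \oo] -->
  \int[lebesgue_measure]_(x in `[t, +oo[) phi x.
Proof.
move=> iphi.
rewrite -(Rintegral_itv_obnd_cbnd (r := t)); last exact: integrableS iphi.
pose f_ n : measurableTypeR R -> \bar R := EFin \o (phi \_ `]t, t + n%:R]).
pose f : measurableTypeR R -> \bar R := EFin \o (phi \_ `]t, +oo[).
have if_ (A : set (measurableTypeR R)) : measurable A -> mu.-integrable setT (EFin \o (phi \_ A)).
  move=> mA; rewrite -restrict_EFin; apply/(integrable_mkcond _ mA).1.
  exact: integrableS iphi.
have mf_ n := measurable_int _ (if_ _ (measurable_itv `]t, t + n%:R])).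
have mf := measurable_int _ (if_ _ (measurable_itv `]t, +oo[)).
have cf : {ae mu, forall x, setT x -> f_ ^~ x @ \oo --> f x}.
  apply: aeW => x _; apply: cvg_EFin => /=; first exact: nearW.
  have [xt|tx] := leP x t.
    have E (b : itv_bound R) : (phi \_ [set` Interval (BRight t) b]) x = 0.
      by rewrite patchE memNset//= in_itv/= ltNge xt.
    rewrite E; apply: cvg_near_cst; apply: nearW => n; exact: E.
  rewrite patchE mem_set ?/= ?in_itv/= ?tx//; apply: cvg_near_cst.
  exists (Num.truncn (x - t)).+1 => // n /= /truncnS_le xn.
  by rewrite patchE mem_set//= in_itv/= tx/= -lerBlDl.
have bf : {ae mu, forall x n, setT x -> (`|f_ n x| <= (abse \o (EFin \o phi)) x)%E}.
  apply: aeW => x n _; rewrite /f_ /= patchE; case: ifP => // _.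
  by rewrite normr0 lee_fin.
have [ifl _ H] := dominated_convergence (@measurableT _ _) mf_ mf cf
  (integrable_abse iphi) bf.
rewrite -(fineK (integrable_fin_num (@measurableT _ _) ifl)) in H.
have -> : \int[mu]_(x in `]t, +oo[) phi x = fine (\int[mu]_x f x)%E.
  by rewrite Rintegral_mkcond.
apply: (cvg_near_eq (fine_cvg H)); apply: nearW => n /=.
by rewrite Rintegral_mkcond.
Qed.

Lemma measurable_scaled_sin {R : realType} (t l : R) :
  measurable_fun (setT : set (measurableTypeR R)) (fun x => l^-1 * sin ((t - x) * l)).
Proof.
apply: continuous_measurable_fun => x.
apply: cvgM; first exact: cvg_cst.
apply: continuous_comp; last exact: continuous_sin.
by apply: cvgM; [apply: cvgB; [exact: cvg_cst|exact: cvg_id]|exact: cvg_cst].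
Qed.

Section duhamel.
Context {R : realType}.
Notation mu := (@lebesgue_measure R).
Variables (v w a : R -> R) (l : R).
Hypothesis l0 : 0 < l.
Hypothesis dv : forall t, 0 <= t -> rderiv v t (w t).
Hypothesis acw : forall T, 0 < T -> ac_on 0 T w.
Hypothesis ia : mu.-integrable Rplus (EFin \o a).
Hypothesis dw : {ae mu, forall t, Rplus t -> rderiv w t (- (l ^+ 2 * v t) - a t)}.
Hypothesis v0 : v x @[x --> +oo] --> 0.
Hypothesis w0 : w x @[x --> +oo] --> 0.

Let S (t x : R) := l^-1 * sin ((t - x) * l).
Let C (t x : R) := cos ((t - x) * l).

Let arg_derive (t x : R) : is_derive x 1 (fun y : R => (t - y) * l) (- l).
Proof.
have H := is_deriveZ l (is_deriveB (is_derive_cst t x 1) (is_derive_id x (1 : R))).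
rewrite (_ : (fun y : R => _) = l *: (cst t - id)); last by apply/funext => y; exact: mulrC.
by apply: (is_derive_eq H); rewrite sub0r scalerN [_ *: _]mulr1.
Qed.

Let S_rderiv (t x : R) : rderiv (S t) x (- C t x).
Proof.
apply: is_derive_rderiv.
have H := is_deriveZ l^-1 (@is_derive1_comp _ (@sin R) (fun y => (t - y) * l) x _ _
  (is_derive_sin _) (arg_derive t x)).
apply: (is_derive_eq H); rewrite [_ *: _]mulrA mulrN -/(C t x).
by rewrite mulrAC mulVf ?gt_eqF// mul1r.
Qed.

Let C_rderiv (t x : R) : rderiv (C t) x (l ^+ 2 * S t x).
Proof.
apply: is_derive_rderiv.
have H := @is_derive1_comp _ (@cos R) (fun y => (t - y) * l) x _ _
  (is_derive_cos _) (arg_derive t x).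
by apply: (is_derive_eq H); rewrite mulrNN /S; field; rewrite gt_eqF.
Qed.

Let F t x := w x * S t x + v x * C t x.
(** The derivative of F, with the source extended by zero to the whole line because [ac_ftc] works
    with an integrand integrable on R. *)
Let phi t x := - (S t x * (a \_ Rplus) x).

Let S_le t x : `|S t x| <= l^-1.
Proof.
have il : 0 <= l^-1 by rewrite invr_ge0 ltW.
rewrite normrM (ger0_norm il) -[X in _ <= X]mulr1 ler_wpM2l//.
by rewrite ler_norml sin_geN1 sin_le1.
Qed.

Let C_le t x : `|C t x| <= 1.
Proof. by rewrite ler_norml cos_geN1 cos_le1. Qed.

Let F_rderiv t : {ae mu, forall x, 0 <= x -> rderiv (F t) x (phi t x)}.
Proof.
have [N [mN N0 HN]] := dw; exists N; split => // x /= Fx; apply: HN => /= H.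
apply: Fx => x0; have xR : Rplus x by rewrite /Rplus /= in_itv/= x0.
have := rderivD (rderivM x0 (H xR) (@S_rderiv t x)) (rderivM x0 (dv x0) (@C_rderiv t x)).
by congr rderiv; rewrite /phi patchE mem_set//; ring.
Qed.

(** Each factor is absolutely continuous and bounded: w by hypothesis, v because its derivative w is
    bounded on [0, T], and S and C because their derivatives are bounded by 1 and l. *)
Let F_ac t T : 0 < T -> ac_on 0 T (F t).
Proof.
move=> T0; have [Mw HMw] := ac_on_bounded (ltW T0) (acw T0).
have Mw0 : 0 <= Mw by apply: le_trans (HMw 0 _); rewrite ?normr_ge0// lexx ltW.
have lv := rderiv_lipschitz (lexx 0) Mw0 (fun x xT => conj (dv (proj1 (andP xT))) (HMw x xT)).
have acv : ac_on 0 T v by apply: lipschitz_ac_on lv; lra.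
have [Mv HMv] := ac_on_bounded (ltW T0) acv.
have acS : ac_on 0 T (S t).
  apply: (lipschitz_ac_on (M := 1 + 1)); first lra.
  apply: (rderiv_lipschitz (f' := fun x => - C t x)) => // x _.
  by rewrite normrN; split; [exact: S_rderiv|exact: C_le].
have acC : ac_on 0 T (C t).
  apply: (lipschitz_ac_on (M := l + 1)); first by rewrite addr_ge0// ltW.
  apply: (rderiv_lipschitz (f' := fun x => l ^+ 2 * S t x) (lexx 0) (ltW l0)) => x _.
  split; first exact: C_rderiv.
  rewrite normrM ger0_norm ?sqr_ge0// (le_trans (ler_wpM2l (sqr_ge0 l) (S_le t x)))//.
  by rewrite expr2 mulfK ?gt_eqF.
apply: ac_onD.
- apply: (ac_onM (M := Num.max Mw l^-1) (acw T0) acS) => x xT.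
    by rewrite le_max HMw.
  by rewrite le_max S_le orbT.
- apply: (ac_onM (M := Num.max Mv 1) acv acC) => x xT.
    by rewrite le_max HMv.
  by rewrite le_max C_le orbT.
Qed.

Let phi_integrable t : mu.-integrable setT (EFin \o phi t).
Proof.
have mS := measurable_scaled_sin t l.
have bS : [bounded S t x | x in (setT : set (measurableTypeR R))].
  by exists l^-1; split; rewrite ?num_real// => M Ml x _ /=; rewrite (le_trans (S_le t x))// ltW.
have mR : measurable (Rplus : set (measurableTypeR R)) by exact: measurable_itv.
have := (integrable_mkcond _ mR).1 ia; rewrite restrict_EFin => ia'.
have := integrableN (integrableMr (@measurableT _ _) mS bS ia').
by apply: eq_integrable => // x _; rewrite /= -EFinM.
Qed.

Theorem duhamel t : 0 <= t ->
  v t = \int[mu]_(x in `[t, +oo[) (l^-1 * sin ((t - x) * l) * a x).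
Proof.
move=> t0.
have FT : \forall n \near \oo, F t (t + n%:R) - F t t = \int[mu]_(x in `]t, t + n%:R]) phi t x.
  exists 1 => // n /= n0; have T0 : 0 < t + n%:R by rewrite ltr_wpDl// ltr0n.
  apply: (ac_ftc (phi_integrable t)) => //; first by rewrite lerDl.
    exact: ac_on_sub (F_ac t T0).
have Ft : F t t = v t.
  by rewrite /F /S /C subrr mul0r sin0 cos0 !mulr0 add0r mulr1.
have Fv : \int[mu]_(x in `[t, +oo[) phi t x =
   - \int[mu]_(x in `[t, +oo[) (l^-1 * sin ((t - x) * l) * a x).
  have itF : mu.-integrable `[t, +oo[ (EFin \o phi t) by exact: integrableS (phi_integrable t).
  rewrite -[LHS]opprK; congr (- _); rewrite -mulN1r -RintegralZl//.
  apply: eq_Rintegral => x; rewrite inE /= in_itv/= andbT => tx.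
  by rewrite /phi patchE mem_set ?mulN1r ?opprK// /Rplus /= in_itv/= (le_trans t0 tx).
have c1 := cvg_integral_tail (t := t) (phi_integrable t).
(* Here the decay of both v and w enters: |F| is at most |w| / l + |v|. *)
have c2 : F t (t + n%:R) - F t t @[n --> \oo] --> 0 - F t t.
  apply: cvgB; last exact: cvg_cst.
  have vT : v (t + n%:R) @[n --> \oo] --> 0.
    exact: cvg_comp (cvgry_addn t) v0.
  have wT : w (t + n%:R) @[n --> \oo] --> 0.
    exact: cvg_comp (cvgry_addn t) w0.
  have B : l^-1 * `|w (t + n%:R)| + `|v (t + n%:R)| @[n --> \oo] --> l^-1 * 0 + 0.
    apply: cvgD; last by rewrite -(normr0 R); exact: cvg_norm.
    by apply: cvgM; [exact: cvg_cst|rewrite -(normr0 R); exact: cvg_norm].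
  rewrite mulr0 addr0 in B.
  have NB : - (l^-1 * `|w (t + n%:R)| + `|v (t + n%:R)|) @[n --> \oo] --> - (0 : R).
    exact: cvgN.
  rewrite oppr0 in NB; apply: (squeeze_cvgr _ NB B).
  apply: nearW => n; rewrite -ler_norml (le_trans (ler_normD _ _))// (normrM (w _)) (normrM (v _)).
  rewrite lerD//; first by rewrite [X in X <= _]mulrC; apply: ler_wpM2r => //; exact: S_le.
  by rewrite -[X in _ <= X]mulr1 ler_wpM2l ?C_le ?normr_ge0.
have c3 : \int[mu]_(x in `]t, t + n%:R]) phi t x @[n --> \oo] --> 0 - F t t.
  exact: (cvg_near_eq c2 FT).
have := cvg_unique _ c3 c1.
by rewrite sub0r Ft Fv => H; apply: oppr_inj; exact: H.
Qed.

End duhamel.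

(** * Norms and integrals *)

Section ae_integral.
Import HBNNSimple.
Context d (T : measurableType d) (R : realType).
Variable nu : {measure set T -> \bar R}.
Local Open Scope ereal_scope.

(* No measurability is assumed here: lebesgue_measure is not complete, so an
   a.e. limit of step functions need not be measurable. *)
Lemma ae_le_integral_nonmeasurable (D : set T) (F G : T -> \bar R) : measurable D ->
  (forall x, D x -> 0 <= F x) -> (forall x, D x -> 0 <= G x) ->
  {ae nu, forall x, D x -> F x <= G x} ->
  \int[nu]_(x in D) F x <= \int[nu]_(x in D) G x.
Proof.
move=> mD F0 G0 [N [mN N0 HN]].
rewrite !ge0_integralE//; apply: ge_ereal_sup => _ [h /= hF <-].
have mNC : measurable (~` N) by exact: measurableC.
(* The integral of F is a supremum over simple functions h below F. Cutting h off on the null set N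
   keeps its integral and puts it below G everywhere. *)
pose h' := mul_nnsfun h (indic_nnsfun R mNC).
have -> : sintegral nu h = sintegral nu h'.
  rewrite -!integralT_nnsfun; apply: ae_eq_integral => //.
  - exact/measurable_EFinP.
  - exact/measurable_EFinP.
  - exists N; split => // x /= H; apply: contrapT => Nx; apply: H => _.
    by rewrite /h' /= /mindic indicE mem_set// mulr1.
apply: ereal_sup_ubound; exists h' => //= x; rewrite /mindic indicE.
have [Nx|Nx] := boolP (x \in ~` N); last first.
  by rewrite mulr0; apply: erestrict_ge0.
rewrite mulr1 (le_trans (hF x))// !patchE; case: ifPn => // xD.
apply: contrapT => H; move: Nx; rewrite inE; apply; apply: HN => /= H'.
by apply: H; apply: H'; rewrite inE in xD.
Qed.

Lemma ae_eq_integral_nonmeasurable (D : set T) (F G : T -> \bar R) : measurable D ->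
  {ae nu, forall x, D x -> F x = G x} ->
  \int[nu]_(x in D) F x = \int[nu]_(x in D) G x.
Proof.
move=> mD [N [mN N0 HN]].
(* Applied with h the positive and the negative part, which reduces the claim to nonnegative
   integrands. *)
have key (h : \bar R -> \bar R) : (forall y, 0 <= h y) ->
    \int[nu]_(x in D) h (F x) = \int[nu]_(x in D) h (G x).
  move=> h0; apply/eqP; rewrite eq_le; apply/andP; split.
  - apply: ae_le_integral_nonmeasurable => //; exists N; split => // x /= H.
    by apply: HN => /= H'; apply: H => Dx; rewrite H'.
  - apply: ae_le_integral_nonmeasurable => //; exists N; split => // x /= H.
    by apply: HN => /= H'; apply: H => Dx; rewrite H'.
rewrite integralE [RHS]integralE; congr (_ - _).
- have pE (f : T -> \bar R) : f^\+ = (fun x => maxe (f x) 0).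
    by apply/funext => x; rewrite funeposE.
  by rewrite !pE; apply: (key (fun y => maxe y 0)) => y; rewrite le_max lexx orbT.
- have nE (f : T -> \bar R) : f^\- = (fun x => maxe (- f x) 0).
    by apply/funext => x; rewrite funenegE.
  by rewrite !nE; apply: (key (fun y => maxe (- y) 0)) => y; rewrite le_max lexx orbT.
Qed.

End ae_integral.

Section rnorm.
Context {R : realType}.

Lemma normr_rnorm {V : normedModType R[i]} (x : V) : `|x| = (rnorm x)%:C.
Proof. by rewrite /rnorm RRe_real// ger0_real. Qed.

(** Positive elements of R[i] are real; this turns the R[i]-valued radii of neighbourhoods into real
    ones. *)
Lemma gt0_complexE (e : R[i]) : 0 < e -> e = (complex.Re e)%:C /\ 0 < complex.Re e.
Proof.
move=> e0; have E : e = (complex.Re e)%:C by rewrite RRe_real// gtr0_real.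
by split=> //; move: e0; rewrite E ltcR.
Qed.

Section space.
Context {V : normedModType R[i]}.
Implicit Types x y : V.

Lemma rnorm_ge0 x : 0 <= rnorm x.
Proof. by have := normr_ge0 x; rewrite normr_rnorm ler0c. Qed.

Lemma rnorm0 : rnorm (0 : V) = 0.
Proof. by rewrite /rnorm normr0. Qed.

Lemma rnorm_eq0 x : rnorm x = 0 -> x = 0.
Proof. by move=> H; apply/normr0_eq0; rewrite normr_rnorm H. Qed.

Lemma rnormN x : rnorm (- x) = rnorm x.
Proof. by rewrite /rnorm normrN. Qed.

Lemma rnormD x y : rnorm (x + y) <= rnorm x + rnorm y.
Proof. by rewrite -lecR rmorphD /= -!normr_rnorm ler_normD. Qed.

Lemma rnormB x y : rnorm (x - y) <= rnorm x + rnorm y.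
Proof. by rewrite (le_trans (rnormD _ _))// rnormN. Qed.

Lemma rnorm_distC x y : rnorm (x - y) = rnorm (y - x).
Proof. by rewrite -rnormN opprB. Qed.

Lemma rnorm_sum (I : Type) (s : seq I) (F : I -> V) :
  rnorm (\sum_(i <- s) F i) <= \sum_(i <- s) rnorm (F i).
Proof.
elim/big_ind2 : _ => //; first by rewrite rnorm0.
by move=> a x b y xa yb; rewrite (le_trans (rnormD _ _))// lerD.
Qed.

Lemma rnormZ (c : R[i]) x : rnorm (c *: x) = rnorm (c : R[i]^o) * rnorm x.
Proof. by apply: complexI; rewrite rmorphM /= -!normr_rnorm normrZ. Qed.

Lemma rnorm_real (r : R) : rnorm (r%:C : R[i]^o) = `|r|.
Proof. by rewrite /rnorm normc_def /= expr0n addr0 sqrtr_sqr. Qed.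

Lemma rnormZr (r : R) x : rnorm (r%:C *: x) = `|r| * rnorm x.
Proof. by rewrite rnormZ rnorm_real. Qed.

Lemma ler_dist_rnorm x y : `|rnorm x - rnorm y| <= rnorm (x - y).
Proof.
rewrite ler_norml; apply/andP; split; last by rewrite lerBlDr -{1}(subrK y x) rnormD.
by rewrite lerNl opprB lerBlDr -{1}(subrK x y) (le_trans (rnormD _ _))// rnorm_distC.
Qed.

Lemma cvg_rnormP {T : Type} (F : set_system T) {FF : Filter F} (f : T -> V) l :
  f x @[x --> F] --> l <->
  forall e : R, 0 < e -> \forall x \near F, rnorm (l - f x) < e.
Proof.
split=> [/cvgrPdist_lt H e e0|H].
  have e0' : 0 < e%:C by rewrite ltcR.
  by have := H _ e0'; apply: filterS => x; rewrite normr_rnorm ltcR.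
apply/cvgrPdist_lt => e /gt0_complexE[-> e0].
by have := H _ e0; apply: filterS => x; rewrite normr_rnorm ltcR.
Qed.

Lemma cvg_rnorm {T : Type} (F : set_system T) {FF : Filter F} (f : T -> V) l :
  f x @[x --> F] --> l -> rnorm (f x) @[x --> F] --> rnorm l.
Proof.
move=> /cvg_rnormP H; apply/cvgrPdist_lt => e e0.
by apply: filterS (H _ e0) => x; apply: le_lt_trans; exact: ler_dist_rnorm.
Qed.

End space.

Lemma Re_le_rnorm (z : R[i]) : `|complex.Re z| <= rnorm (z : R[i]^o).
Proof. by have := normc_ge_Re z; rewrite (@normr_rnorm R[i]^o) lecR. Qed.

Lemma Im_le_rnorm (z : R[i]) : `|complex.Im z| <= rnorm (z : R[i]^o).
Proof.
by rewrite /rnorm normc_def /= -sqrtr_sqr; apply: ler_wsqrtr; rewrite lerDr sqr_ge0.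
Qed.

Lemma rnorm_le_ReIm (z : R[i]) : rnorm (z : R[i]^o) <= `|complex.Re z| + `|complex.Im z|.
Proof.
rewrite {1}[z]complexE (le_trans (rnormD _ _))// rnorm_real lerD2l.
by rewrite /rnorm normc_def /= !(mul0r, mul1r, mulr0, subrr, oppr0, add0r, expr0n)/= sqrtr_sqr.
Qed.

End rnorm.

(** * Bochner integrals *)

(** Holds for an arbitrary F, so it can move the error integral of [step_approx] off the exceptional
    null set before its integrand is known to be measurable. *)
Lemma integral_null_setD d (T : measurableType d) {R : realType}
    (nu : {measure set T -> \bar R}) (D N : set T) (F : T -> \bar R) :
  measurable D -> measurable N -> nu N = 0%E ->
  (\int[nu]_(x in D) F x = \int[nu]_(x in D `\` N) F x)%E.
Proof.
move=> mD mN N0; rewrite [LHS]integral_mkcond [RHS]integral_mkcond.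
apply: ae_eq_integral_nonmeasurable => //.
exists N; split => // x /= H; apply: contrapT => Nx; apply: H => _.
by rewrite !patchE in_setD (memNset Nx) andbT.
Qed.

Lemma squeeze_cvge0 {R : realType} (u v : nat -> \bar R) :
  (forall n, 0 <= u n)%E -> (forall n, u n <= v n)%E ->
  v n @[n --> \oo] --> 0%E -> u n @[n --> \oo] --> 0%E.
Proof.
move=> u0 uv v0; apply: (squeeze_cvge _ (cvg_cst 0%E) v0).
by apply: nearW => n; rewrite u0 uv.
Qed.

Lemma integrable_indic_lty d (T : measurableType d) {R : realType}
    (nu : {measure set T -> \bar R}) (A : set T) :
  measurable A -> (nu A < +oo)%E -> nu.-integrable setT (fun x => (\1_A x)%:E).
Proof.
move=> mA fA; apply/integrableP; split.
  by apply/measurable_EFinP; exact: measurable_indic.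
under eq_integral => t _ do rewrite gee0_abs ?lee_fin//.
by rewrite integral_indic// setIT.
Qed.

Section bochner.
Context {R : realType} {V : normedModType R[i]}.
Implicit Types (D : set (measurableTypeR R)) (s : seq (set R * V)) (f : R -> V).

Lemma step_nil x : step ([::] : seq (set R * V)) x = 0.
Proof. by rewrite /step big_nil. Qed.

Lemma step_cons p s x : step (p :: s) x = (\1_(p.1) x)%:C *: p.2 + step s x.
Proof. by rewrite /step big_cons. Qed.

Lemma step_cat s s' x : step (s ++ s') x = step s x + step s' x.
Proof. by rewrite /step big_cat. Qed.

Lemma stepB s s' x :
  step (s ++ [seq (p.1, - p.2) | p <- s']) x = step s x - step s' x.
Proof.
rewrite step_cat; congr (_ + _); rewrite /step big_map -sumrN.
by apply: eq_bigr => p _; rewrite scalerN.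
Qed.

Lemma step_integralB s s' :
  step_integral (s ++ [seq (p.1, - p.2) | p <- s']) = step_integral s - step_integral s'.
Proof.
rewrite /step_integral big_cat big_map -sumrN; congr (_ + _).
by apply: eq_bigr => p _; rewrite scalerN.
Qed.

Lemma step_onB D s s' : step_on D s -> step_on D s' ->
  step_on D (s ++ [seq (p.1, - p.2) | p <- s']).
Proof.
by move=> sD sD' q; rewrite mem_cat => /orP[/sD//|/mapP[p /sD' ? ->]].
Qed.

Lemma step_onS D p s : step_on D (p :: s) ->
  [/\ measurable (p.1 : set (measurableTypeR R)), p.1 `<=` D,
     (mu p.1 < +oo)%E & step_on D s].
Proof.
move=> H; have [] := H p (mem_head _ _); split => // q qs.
by apply: H; rewrite inE qs orbT.
Qed.

(** A step function takes finitely many values, each on a measurable set, so any h can be applied to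
    it. The shift v accumulates the vectors of the pairs already treated by the induction. *)
Lemma measurable_step D (h : V -> R) s v : step_on D s ->
  measurable_fun (setT : set (measurableTypeR R)) (fun x => h (v + step s x)).
Proof.
elim: s v => [v _|p s IH v /step_onS[mp _ _ /IH {}IH]].
  by under eq_fun do rewrite step_nil addr0; exact: measurable_cst.
rewrite (_ : (fun x => _) = (fun x => \1_(p.1) x * h ((v + p.2) + step s x) +
   (1 - \1_(p.1) x) * h (v + step s x))).
  have mi : measurable_fun (setT : set (measurableTypeR R)) (\1_(p.1) : R -> R).
    exact: measurable_indic.
  apply: measurable_funD; apply: measurable_funM => //.
  exact: measurable_funB.
apply/funext => x; rewrite step_cons indicE; case: (x \in p.1) => /=.
  by rewrite scale1r addrA mul1r subrr mul0r addr0.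
by rewrite scale0r add0r mul0r subr0 mul1r add0r.
Qed.

Lemma integrable_rnorm_step D s : step_on D s ->
  mu.-integrable (setT : set (measurableTypeR R)) (EFin \o (fun x => rnorm (step s x))).
Proof.
elim: s => [_|p s IH /[dup] sD /step_onS[mp _ pf /IH {}IH]].
  by under eq_fun do rewrite step_nil rnorm0; exact: integrable0.
have ip : mu.-integrable (setT : set (measurableTypeR R))
    (EFin \o (fun x => rnorm p.2 * \1_(p.1) x)).
  rewrite (_ : _ \o _ = (fun x => (rnorm p.2)%:E * (\1_(p.1) x)%:E)%E)//.
  by apply: integrableZl => //; exact: integrable_indic_lty.
apply: le_integrable (integrableD _ ip IH) => //.
  apply/measurable_EFinP.
  by have := measurable_step (@rnorm _ _) 0 sD; under eq_fun do rewrite add0r.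
move=> x _; rewrite /= lee_fin !ger0_norm ?addr_ge0 ?mulr_ge0 ?rnorm_ge0//.
rewrite step_cons (le_trans (rnormD _ _))// lerD2r rnormZr mulrC.
by rewrite ger0_norm.
Qed.

End bochner.

Section step_limits.
Context {R : realType} {V : normedModType R[i]}.
Implicit Types (D E N : set (measurableTypeR R)) (s : seq (set R * V)) (f g : R -> V).

(** Bounded real-linear functionals. The real and imaginary parts of a coefficient are of this kind,
    so vector-valued statements reduce to the Lebesgue integral of real functions. *)
Definition real_bounded (l : V -> R) (K : R) :=
  [/\ 0 <= K, {morph l : x y / x + y}, forall (r : R) x, l (r%:C *: x) = r * l x &
      forall x, `|l x| <= K * rnorm x].

Lemma real_bounded0 l K : real_bounded l K -> l 0 = 0.
Proof. by case=> _ lD _ _; apply: (addrI (l 0)); rewrite -lD !addr0. Qed.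

Lemma real_boundedB l K x y : real_bounded l K -> l (x - y) = l x - l y.
Proof.
move=> [_ lD lZ _]; rewrite lD -[- y]scaleN1r.
by have := lZ (-1) y; rewrite rmorphN1 mulN1r => ->.
Qed.

Lemma real_bounded_integrable_step D s l K : real_bounded l K -> step_on D s ->
  mu.-integrable (setT : set (measurableTypeR R)) (EFin \o (fun x => l (step s x))).
Proof.
move=> [K0 lD lZ lK] sD; have i := integrableZl (@measurableT _ _) K (integrable_rnorm_step sD).
apply: le_integrable i => //.
  apply/measurable_EFinP.
  by have := measurable_step l 0 sD; under eq_fun do rewrite add0r.
move=> x _; rewrite /= lee_fin (le_trans (lK _))//.
by rewrite ger0_norm ?mulr_ge0 ?rnorm_ge0.
Qed.

Lemma real_bounded_step_integral D s l K : measurable D -> real_bounded l K -> step_on D s ->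
  l (step_integral s) = \int[mu]_(x in D) l (step s x).
Proof.
move=> mD lK; elim: s => [_|p s IH /[dup] spD /step_onS[mp pD pf sD]].
  under eq_Rintegral do rewrite step_nil (real_bounded0 lK).
  by rewrite /step_integral big_nil (real_bounded0 lK) Rintegral_cst// mul0r.
have [K0 lD lZ _] := lK.
rewrite /step_integral big_cons lD lZ -/(step_integral s) IH//.
under [RHS]eq_Rintegral do rewrite step_cons lD lZ.
have ip : mu.-integrable D (EFin \o (fun x : R => \1_(p.1) x * l p.2)).
  have : mu.-integrable D (EFin \o (fun x => l (step [:: p] x))).
    apply: (@integrableS _ _ _ _ setT) => //.
    apply: (@real_bounded_integrable_step D) lK _ => q; rewrite inE => /eqP ->.
    by split.
  by under eq_fun do rewrite step_cons step_nil addr0 lZ.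
rewrite RintegralD//; last first.
  by apply: (@integrableS _ _ _ _ setT) => //; exact: real_bounded_integrable_step lK sD.
congr (_ + _); rewrite RintegralZr//; last first.
  by apply: (@integrableS _ _ _ _ setT) => //; exact: integrable_indic_lty.
by rewrite /Rintegral integral_indic// setIidl.
Qed.

Lemma step_approx_null D f (t : nat -> seq (set R * V)) : step_approx D f t ->
  exists N, [/\ measurable N, mu N = 0%E &
    forall x, (D `\` N) x -> step (t n) x @[n --> \oo] --> f x].
Proof.
move=> [_ [N [mN N0 HN]] _]; exists N; split => // x [Dx Nx].
by apply: contrapT => H; apply: Nx; apply: HN => /= /(_ Dx).
Qed.

Lemma measurable_step_limit D E (t : nat -> seq (set R * V)) f (h : V -> R) :
  measurable E -> (forall n, step_on D (t n)) ->
  (forall x, E x -> step (t n) x @[n --> \oo] --> f x) ->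
  (forall (w : nat -> V) l, w n @[n --> \oo] --> l -> h (w n) @[n --> \oo] --> h l) ->
  measurable_fun E (h \o f).
Proof.
move=> mE tD tf hc; apply: (measurable_fun_cvg (h := fun n x => h (step (t n) x))).
  move=> n; apply: (@measurable_funS _ _ _ _ setT) => //.
  by have := measurable_step h 0 (tD n); under eq_fun do rewrite add0r.
by move=> x Ex; apply: hc; exact: tf.
Qed.

Lemma rnorm_cvgn (w : nat -> V) l y : w n @[n --> \oo] --> l ->
  rnorm (w n - y) @[n --> \oo] --> rnorm (l - y).
Proof. by move=> wl; apply: cvg_rnorm; apply: cvgB => //; exact: cvg_cst. Qed.

Lemma measurable_rnorm_limit D E (t : nat -> seq (set R * V)) f m :
  measurable E -> (forall n, step_on D (t n)) ->
  (forall x, E x -> step (t n) x @[n --> \oo] --> f x) ->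
  measurable_fun E (fun x => rnorm (f x - step (t m) x)).
Proof.
move=> mE tD tf.
pose h n x : R := rnorm (step (t n) x - step (t m) x).
apply: (measurable_fun_cvg (h := h)); last by move=> x Ex; exact: rnorm_cvgn (tf x Ex).
move=> n; apply: (@measurable_funS _ _ _ _ setT) => //.
have := measurable_step (@rnorm _ _) 0 (step_onB (tD n) (tD m)).
by under eq_fun do rewrite add0r stepB.
Qed.

Lemma step_approx_of_dominated D N (t : nat -> seq (set R * V)) f (B : R -> R) :
  measurable D -> measurable N -> mu N = 0%E -> (forall n, step_on D (t n)) ->
  (forall x, (D `\` N) x -> step (t n) x @[n --> \oo] --> f x) ->
  mu.-integrable (D `\` N) (EFin \o B) ->
  (forall n x, (D `\` N) x -> rnorm (step (t n) x) <= B x) ->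
  step_approx D f t.
Proof.
move=> mD mN N0 tD tf iB tB; split => //.
  exists N; split => // x /= H; apply: contrapT => Nx; apply: H => Dx.
  exact: tf.
have mE : measurable (D `\` N) by exact: measurableD.
under eq_fun do rewrite (integral_null_setD _ mD mN N0).
pose h n : measurableTypeR R -> \bar R := fun x => (rnorm (f x - step (t n) x))%:E.
have mh n : measurable_fun (D `\` N) (h n).
  by apply/measurable_EFinP; exact: measurable_rnorm_limit tf.
have m0 : measurable_fun (D `\` N) (cst 0%E : measurableTypeR R -> \bar R).
  exact: measurable_cst.
have ch : {ae mu, forall x, (D `\` N) x -> h ^~ x @ \oo --> 0%E}.
  apply: aeW => x xE; apply: cvg_EFin; first exact: nearW.
  have := rnorm_cvgn (y := f x) (tf x xE); rewrite subrr rnorm0.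
  by under eq_fun do rewrite rnorm_distC.
have fB x : (D `\` N) x -> rnorm (f x) <= B x.
  move=> xE; apply: (cvgr_to_le (cvg_rnorm (tf x xE))).
  by apply: nearW => n; exact: tB.
(* The bound B passes to the limit f, hence 2 B dominates the errors. *)
have iB2 := integrableZl mE 2 iB.
have bh : {ae mu, forall x n, (D `\` N) x -> (`|h n x| <= 2%:E * (EFin \o B) x)%E}.
  apply: aeW => x n xE; rewrite /= lee_fin ger0_norm ?rnorm_ge0//.
  rewrite (le_trans (rnormB _ _))//.
  by have := fB x xE; have := tB n x xE; lra.
have [_ _] := dominated_convergence mE mh m0 ch iB2 bh.
by rewrite integral0.
Qed.

End step_limits.

Section bochner_functionals.
Context {R : realType} {V : normedModType R[i]}.
Implicit Types (D E N : set (measurableTypeR R)) (s : seq (set R * V)) (f g : R -> V).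

(** Error integrals converging to 0 are eventually finite. One finite error makes |f| integrable by
    the triangle inequality, and then all the errors are integrable. *)
Lemma integrable_rnorm_limit D N (t : nat -> seq (set R * V)) f :
  measurable D -> measurable N -> mu N = 0%E -> step_approx D f t ->
  (forall x, (D `\` N) x -> step (t n) x @[n --> \oo] --> f x) ->
  (forall n, mu.-integrable (D `\` N) (EFin \o (fun x => rnorm (f x - step (t n) x)))) /\
  mu.-integrable (D `\` N) (EFin \o (fun x => rnorm (f x))).
Proof.
move=> mD mN N0 [tD _ t0] tf; have mE : measurable (D `\` N) by exact: measurableD.
have mfs n : measurable_fun (D `\` N) (EFin \o (fun x => rnorm (f x - step (t n) x))).
  by apply/measurable_EFinP; exact: measurable_rnorm_limit tf.
have mf : measurable_fun (D `\` N) (EFin \o (fun x => rnorm (f x))).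
  apply/measurable_EFinP; apply: (measurable_step_limit mE tD tf) => w l.
  exact: cvg_rnorm.
have is_ n : mu.-integrable (D `\` N) (EFin \o (fun x => rnorm (step (t n) x))).
  by apply: (@integrableS _ _ _ _ setT) => //; exact: integrable_rnorm_step (tD n).
have [m Hm] : exists m, (\int[mu]_(x in D) (rnorm (f x - step (t m) x))%:E < +oo)%E.
  have /fine_cvgP[[m _ /(_ m (leqnn m)) Hm] _] := t0; exists m.
  by rewrite -ge0_fin_numE// integral_ge0// => x _; rewrite lee_fin rnorm_ge0.
have ifm : mu.-integrable (D `\` N) (EFin \o (fun x => rnorm (f x - step (t m) x))).
  apply/integrableP; split => //; rewrite (integral_null_setD _ mD mN N0) in Hm.
  by under eq_integral => x _ do rewrite gee0_abs ?lee_fin ?rnorm_ge0//.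
have if_ : mu.-integrable (D `\` N) (EFin \o (fun x => rnorm (f x))).
  apply: le_integrable (integrableD mE ifm (is_ m)) => // x xE.
  rewrite /= lee_fin !ger0_norm ?addr_ge0 ?rnorm_ge0//.
  by rewrite -{1}(subrK (step (t m) x) (f x)) rnormD.
split => // n; apply: le_integrable (integrableD mE if_ (is_ n)) => // x xE.
by rewrite /= lee_fin !ger0_norm ?addr_ge0 ?rnorm_ge0// rnormB.
Qed.

Lemma cvg_real_bounded {T : Type} (F : set_system T) {FF : Filter F}
    (l : V -> R) K (w : T -> V) y : real_bounded l K ->
  w n @[n --> F] --> y -> l (w n) @[n --> F] --> l y.
Proof.
move=> lb wy; have [K0 _ _ lK] := lb; apply/cvgrPdist_lt => e e0.
have K1 : 0 < K + 1 by rewrite ltr_wpDl.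
have /cvg_rnormP /(_ _ (divr_gt0 e0 K1)) := wy; apply: filterS => n.
rewrite ltr_pdivlMr// => H; rewrite -(real_boundedB _ _ lb) (le_lt_trans (lK _))//.
by rewrite mulrC (le_lt_trans _ H)// ler_wpM2l ?rnorm_ge0// lerDl.
Qed.

(** The numbers l (step_integral (t n)) tend to l v; they also tend to the integral of l f, from
    which they differ by at most K times the error integral. *)
Lemma real_bounded_bochner D f v l K : measurable D -> real_bounded l K ->
  is_bochner_integral D f v -> l v = \int[mu]_(x in D) l (f x).
Proof.
move=> mD lb [t tf tv]; have [tD _ t0] := tf; have [K0 _ _ lK] := lb.
have [N [mN N0 HN]] := step_approx_null tf.
have mE : measurable (D `\` N) by exact: measurableD.
have [ift if_] := integrable_rnorm_limit mD mN N0 tf HN.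
have ilt n : mu.-integrable (D `\` N) (EFin \o (fun x => l (step (t n) x))).
  apply: (@integrableS _ _ _ _ setT) => //.
  exact: real_bounded_integrable_step lb (tD n).
have ilf : mu.-integrable (D `\` N) (EFin \o (fun x => l (f x))).
  apply: le_integrable (integrableZl mE K if_) => //.
    apply/measurable_EFinP; apply: (measurable_step_limit mE tD HN) => w y.
    exact: cvg_real_bounded lb.
  by move=> x _; rewrite /= lee_fin [leRHS]ger0_norm// mulr_ge0// rnorm_ge0.
rewrite {1}/Rintegral (integral_null_setD _ mD mN N0) -/(Rintegral _ _ _).
have c1 : l (step_integral (t n)) @[n --> \oo] --> l v by exact: cvg_real_bounded lb tv.
suff c2 : l (step_integral (t n)) @[n --> \oo] --> \int[mu]_(x in D `\` N) l (f x).
  exact: (cvg_unique _ c1 c2).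
have e0 : K * \int[mu]_(x in D `\` N) rnorm (f x - step (t n) x) @[n --> \oo] --> 0.
  rewrite -(mulr0 K); apply: cvgM; first exact: cvg_cst.
  have -> : 0 = fine (0%E : \bar R) by [].
  apply: fine_cvg; move: t0.
  by under eq_fun do rewrite (integral_null_setD _ mD mN N0).
apply/cvgrPdist_le => e e1; move/cvgrPdist_le : e0 => /(_ _ e1).
apply: filterS => n; rewrite sub0r normrN => /(le_trans (ler_norm _)); apply: le_trans.
rewrite (real_bounded_step_integral mD lb (tD n)) {2}/Rintegral (integral_null_setD _ mD mN N0).
rewrite -/(Rintegral _ _ _) -RintegralB// -RintegralZl//.
have ifl : mu.-integrable (D `\` N) (EFin \o (fun x => l (f x) - l (step (t n) x))).
  exact: (integrableB mE ilf (ilt n)).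
rewrite (le_trans (le_normr_Rintegral mE ifl))//; apply: le_Rintegral => //.
- exact: integrable_norm ifl.
- exact: (integrableZl mE K (ift n)).
- by move=> x _; rewrite -(real_boundedB _ _ lb).
Qed.

End bochner_functionals.

Section bochner_unique.
Context {R : realType} {V : normedModType R[i]}.
Variable D : set (measurableTypeR R).
Hypothesis mD : measurable D.
Hypothesis sepV : forall x : V, (forall l K, real_bounded l K -> l x = 0) -> x = 0.

(** Two values, possibly obtained from different approximating sequences, agree under every
    functional, as both give the integral of l f. *)
Lemma bochner_integralE (f : R -> V) v :
  is_bochner_integral D f v -> bochner_integral D f = v.
Proof.
move=> fv; rewrite /bochner_integral; case: xgetP => [w -> fw|/(_ v)//].
apply/eqP; rewrite -subr_eq0; apply/eqP; apply: sepV => l K lb.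
rewrite (real_boundedB _ _ lb) (real_bounded_bochner mD lb fv).
by rewrite (real_bounded_bochner mD lb fw) subrr.
Qed.

End bochner_unique.

Section bochner_push.
Context {R : realType} {V W : normedModType R[i]}.
Variables (D : set (measurableTypeR R)) (T : {linear V -> W}) (K : R).
Hypothesis mD : measurable D.
Hypothesis K0 : 0 <= K.
Hypothesis TK : forall x, rnorm (T x) <= K * rnorm x.

Let push (s : seq (set R * V)) : seq (set R * W) := [seq (p.1, T p.2) | p <- s].

Let step_push s x : step (push s) x = T (step s x).
Proof.
by rewrite /step big_map linear_sum; apply: eq_bigr => p _; rewrite linearZ.
Qed.

Lemma cvg_bounded_linear (F : set_system nat) (FF : Filter F) (w : nat -> V) y :
  w n @[n --> F] --> y -> T (w n) @[n --> F] --> T y.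
Proof.
move=> wy; have K1 : 0 < K + 1 by rewrite ltr_wpDl.
apply/cvg_rnormP => e e0; have /cvg_rnormP /(_ _ (divr_gt0 e0 K1)) := wy.
apply: filterS => n; rewrite ltr_pdivlMr// => H; rewrite -linearB (le_lt_trans (TK _))//.
by rewrite mulrC (le_lt_trans _ H)// ler_wpM2l ?rnorm_ge0// lerDl.
Qed.

Lemma step_approx_push f t : step_approx D f t ->
  step_approx D (T \o f) (push \o t).
Proof.
move=> tf; have [tD [N' [mN' N'0 HN']] t0] := tf; split.
- by move=> n q /mapP[p /(tD n) ? ->].
- exists N'; split => // x /= H; apply: HN' => /= H'; apply: H => Dx.
  by under eq_fun do rewrite step_push; apply: cvg_bounded_linear; exact: H'.
have [N [mN N0 HN]] := step_approx_null tf.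
have mE : measurable (D `\` N) by exact: measurableD.
have [ift _] := integrable_rnorm_limit mD mN N0 tf HN.
have K0e : (K%:E * \int[mu]_(x in D) (rnorm (f x - step (t n) x))%:E)%E @[n --> \oo] --> 0%E.
  by rewrite -(mule0 K%:E); apply: cvgeZl.
apply: (squeeze_cvge0 _ _ K0e) => n.
  by apply: integral_ge0 => x _; rewrite lee_fin rnorm_ge0.
rewrite [X in (_ <= _ * X)%E](integral_null_setD _ mD mN N0).
rewrite -ge0_integralZl_EFin//; last 2 first.
- by move=> x _; rewrite lee_fin rnorm_ge0.
- by have /integrableP[] := ift n.
rewrite (integral_null_setD _ mD mN N0); apply: ae_le_integral_nonmeasurable => //.
- by move=> x _; rewrite lee_fin rnorm_ge0.
- by move=> x _; rewrite -EFinM lee_fin mulr_ge0// rnorm_ge0.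
- by apply: aeW => x _; rewrite -EFinM lee_fin /= step_push -linearB; exact: TK.
Qed.

(** Applied later to negation and to the coefficient functionals, so that the formulas at time 0
    follow from the vector representation. *)
Lemma is_bochner_integral_push f v : is_bochner_integral D f v ->
  is_bochner_integral D (T \o f) (T v).
Proof.
move=> [t tf tv]; exists (push \o t); first exact: step_approx_push.
rewrite (_ : (fun n => _) = (fun n => T (step_integral (t n)))).
  exact: cvg_bounded_linear tv.
apply/funext => n; rewrite /= /step_integral big_map linear_sum.
by apply: eq_bigr => p _; rewrite linearZ.
Qed.

End bochner_push.

Lemma Re_real_bounded {R : realType} : real_bounded (@complex.Re R : R[i]^o -> R) 1.
Proof.
split => //.
- by move=> [a b] [c d].
- by move=> r [a b] /=; rewrite mul0r subr0.
- by move=> z; rewrite mul1r; exact: Re_le_rnorm.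
Qed.

Lemma Im_real_bounded {R : realType} : real_bounded (@complex.Im R : R[i]^o -> R) 1.
Proof.
split => //.
- by move=> [a b] [c d].
- by move=> r [a b] /=; rewrite mul0r addr0.
- by move=> z; rewrite mul1r; exact: Im_le_rnorm.
Qed.

Lemma complex_functionals_separate {R : realType} (x : R[i]^o) :
  (forall l K, real_bounded l K -> l x = 0) -> x = 0.
Proof.
move=> H; rewrite [x]complexE (H _ _ Re_real_bounded) (H _ _ Im_real_bounded).
by rewrite mulr0 addr0.
Qed.

(** * Orthonormal bases *)

#[local] Existing Instance totally_filter.

Section hilbert.
Context {R : realType} {H : completeNormedModType R[i]}.
Variable dot : {dot H for @Num.conj R[i]}.
Hypothesis H_hilbert : forall x : H, `|x| ^+ 2 = dot x x.
Implicit Types x y z : H.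

Lemma dot_rnorm x : dot x x = (rnorm x ^+ 2)%:C.
Proof. by rewrite -H_hilbert (@normr_rnorm _ H) rmorphXn. Qed.

Lemma dotC x y : dot x y = Num.conj (dot y x).
Proof. by rewrite hermC expr0 mul1r. Qed.

Lemma rnorm_pythagoras x y : dot x y = 0 ->
  rnorm (x + y) ^+ 2 = rnorm x ^+ 2 + rnorm y ^+ 2.
Proof.
move=> xy; apply: complexI; rewrite rmorphD /= -!dot_rnorm.
exact: hnormDd.
Qed.

Lemma cauchy_schwarz x y : rnorm (dot x y : R[i]^o) <= rnorm x * rnorm y.
Proof.
have [->|y0] := eqVneq y 0; first by rewrite linear0r !rnorm0 mulr0.
have ny0 : 0 < rnorm y.
  by rewrite lt_def rnorm_ge0 andbT; apply: contra y0 => /eqP /rnorm_eq0 ->.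
have dy : dot y y != 0 by rewrite dnorm_eq0.
(* c *: y is the orthogonal projection of x on y; by Pythagoras its norm is at most that of x. *)
set c := dot x y / dot y y.
have orth : dot (x - c *: y) (c *: y) = 0.
  rewrite linearZr_LR linearBl linearZl_LR /= /c divfK// subrr mulr0 //.
have := rnorm_pythagoras orth; rewrite subrK rnormZ => E.
have nc : rnorm (c : R[i]^o) = rnorm (dot x y : R[i]^o) / rnorm y ^+ 2.
  have sE : (rnorm y ^+ 2)^-1%:C = (dot y y)^-1 :> R[i] by rewrite dot_rnorm fmorphV.
  rewrite /c -sE mulrC -[X in rnorm X]/((rnorm y ^+ 2)^-1%:C *: (dot x y : R[i]^o)).
  by rewrite rnormZr ger0_norm ?invr_ge0 ?sqr_ge0// mulrC.
have : (rnorm (c : R[i]^o) * rnorm y) ^+ 2 <= rnorm x ^+ 2.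
  by rewrite E lerDr sqr_ge0.
rewrite ler_sqr ?nnegrE ?mulr_ge0 ?rnorm_ge0// nc expr2 invfM mulrA mulfVK ?gt_eqF//.
by rewrite ler_pdivrMr.
Qed.

Lemma cvg_dotl {T : Type} (F : set_system T) {FF : Filter F} (f : T -> H) l y :
  f t @[t --> F] --> l -> (dot (f t) y : R[i]^o) @[t --> F] --> (dot l y : R[i]^o).
Proof.
move=> /cvg_rnormP fl; apply/cvg_rnormP => e e0.
have y1 : 0 < rnorm y + 1 by rewrite ltr_wpDl// rnorm_ge0.
apply: filterS (fl _ (divr_gt0 e0 y1)) => t; rewrite ltr_pdivlMr// => H'.
rewrite -linearBl (le_lt_trans (cauchy_schwarz _ _))// (le_lt_trans _ H')//.
by rewrite ler_wpM2l ?rnorm_ge0// lerDl.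
Qed.

Lemma cvg_dotr {T : Type} (F : set_system T) {FF : Filter F} (f : T -> H) l x :
  f t @[t --> F] --> l -> (dot x (f t) : R[i]^o) @[t --> F] --> (dot x l : R[i]^o).
Proof.
move=> /cvg_rnormP fl; apply/cvg_rnormP => e e0.
have x1 : 0 < rnorm x + 1 by rewrite ltr_wpDl// rnorm_ge0.
apply: filterS (fl _ (divr_gt0 e0 x1)) => t; rewrite ltr_pdivlMr// => H'.
rewrite -linearBr (le_lt_trans (cauchy_schwarz _ _))// (le_lt_trans _ H')//.
by rewrite mulrC ler_wpM2l ?rnorm_ge0// lerDl.
Qed.

Section basis.
Context {I : countType} (psi : I -> H).
Hypothesis psi_basis : orthonormal_basis dot psi.

Definition fourier_sum (J : seq I) (c : I -> R[i]) : H := \sum_(k <- J) c k *: psi k.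

Let coef x : I -> R[i] := fun k => dot x (psi k).

Let dot_psi i j : dot (psi i) (psi j) = (i == j)%:R.
Proof. by have [] := psi_basis. Qed.

Lemma rnorm_basis j : rnorm (psi j) = 1.
Proof.
have /complexI /eqP : ((rnorm (psi j)) ^+ 2)%:C = (1 : R)%:C :> R[i].
  by rewrite -dot_rnorm dot_psi eqxx.
rewrite sqrf_eq1 => /orP[/eqP//|/eqP H'].
by have := rnorm_ge0 (psi j); rewrite H' oppr_ge0 ler10.
Qed.

Lemma coef_fourier_sum J c k : uniq J ->
  dot (fourier_sum J c) (psi k) = if k \in J then c k else 0.
Proof.
move=> uJ; rewrite /fourier_sum linear_sumlz.
under eq_bigr do rewrite /= linearZl_LR /= dot_psi mulr_natr mulrb.
case: ifPn => kJ; last first.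
  by rewrite big1_seq// => i /andP[_ iJ]; case: eqP => // ik; rewrite -ik iJ in kJ.
by rewrite (bigD1_seq k)//= eqxx big1 ?addr0// => i /negPf ->.
Qed.

Lemma rnorm_fourier_sum J c : uniq J ->
  rnorm (fourier_sum J c) ^+ 2 = \sum_(k <- J) rnorm (c k : R[i]^o) ^+ 2.
Proof.
elim: J => [_|j J IH /= /andP[jJ uJ]].
  by rewrite /fourier_sum !big_nil rnorm0 expr0n.
rewrite /fourier_sum !big_cons -/(fourier_sum J c) rnorm_pythagoras ?IH//.
  congr (_ + _); rewrite rnormZ.
  by rewrite rnorm_basis mulr1.
by rewrite dotC linearZr_LR /= coef_fourier_sum// (negPf jJ) mulr0 rmorph0.
Qed.

Lemma fourier_sumB J c c' :
  fourier_sum J c - fourier_sum J c' = fourier_sum J (fun k => c k - c' k).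
Proof. by rewrite /fourier_sum -sumrB; apply: eq_bigr => k _; rewrite scalerBl. Qed.

Lemma dot_fourier_sum_eq0 x J c :
  (forall k, k \in J -> dot x (psi k) = 0) -> dot x (fourier_sum J c) = 0.
Proof.
move=> xJ; rewrite /fourier_sum linear_sumr big1_seq// => k /andP[_ kJ].
by rewrite linearZr_LR /= xJ// mulr0.
Qed.

(** The remainder of x after its Fourier sum is orthogonal to psi k for k in J, so Pythagoras
    applies: the Fourier sum is the best approximation. *)
Lemma fourier_sum_best J c x : uniq J -> rnorm (x - fourier_sum J c) ^+ 2 =
  rnorm (x - fourier_sum J (coef x)) ^+ 2 + rnorm (fourier_sum J (coef x) - fourier_sum J c) ^+ 2.
Proof.
move=> uJ; rewrite -rnorm_pythagoras ?subrKA// fourier_sumB.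
apply: dot_fourier_sum_eq0 => k kJ.
by rewrite linearBl /= coef_fourier_sum// kJ subrr.
Qed.

Lemma bessel J x : uniq J -> rnorm (fourier_sum J (coef x)) <= rnorm x.
Proof.
move=> uJ; rewrite -ler_sqr ?nnegrE ?rnorm_ge0//.
have Z : fourier_sum J (fun=> 0) = 0.
  by rewrite /fourier_sum big1// => k _; rewrite scale0r.
by have := fourier_sum_best (fun=> 0) x uJ; rewrite Z !subr0 => ->; rewrite lerDr sqr_ge0.
Qed.

(** Density gives a finite combination y close to x; once J' contains the indices of y, the Fourier
    sum over J' is at least as close. *)
Lemma fourier_dense x e : 0 < e -> exists2 J, uniq J &
  forall J', uniq J' -> {subset J <= J'} -> rnorm (x - fourier_sum J' (coef x)) < e.
Proof.
move=> e0; have [_ dpsi] := psi_basis.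
have [y [/= xy [s [c yE]]]] : (ball x e%:C) `&` [set x | exists (s : seq I) (c : I -> R[i]),
     x = \sum_(i <- s) c i *: psi i] !=set0.
  have e0' : 0 < e%:C by rewrite ltcR.
  by apply: dpsi; [exists x; exact: ballxx|exact: ball_open].
(* The list s may repeat indices, so y is rewritten with its own coefficients; the difference d of
   the two expressions is orthogonal to both, hence to itself. *)
have [c' yE'] : exists c', forall J', uniq J' -> {subset s <= J'} -> y = fourier_sum J' c'.
  exists (dot y \o psi) => J' uJ' sJ'; apply/eqP; rewrite -subr_eq0; apply/eqP.
  apply: rnorm_eq0; apply/eqP; rewrite -sqrf_eq0; apply/eqP; apply: complexI.
  rewrite -dot_rnorm.
  have o k : k \in J' -> dot (y - fourier_sum J' (dot y \o psi)) (psi k) = 0.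
    by move=> kJ'; rewrite linearBl /= coef_fourier_sum// kJ' subrr.
  set d := y - _ in o *.
  have E1 := dot_fourier_sum_eq0 (dot y \o psi) o.
  have E2 : dot d y = 0.
    by rewrite yE; apply: (@dot_fourier_sum_eq0 _ s c) => k ks; apply: o; apply: sJ'.
  have -> : dot d d = dot d y - dot d (fourier_sum J' (dot y \o psi)) by rewrite -linearBr.
  by rewrite E1 E2 subrr.
exists (undup s); first exact: undup_uniq.
move=> J' uJ' sJ'; apply: (@le_lt_trans _ _ (rnorm (x - y))); last first.
  by move: xy; rewrite -ball_normE /ball_ /= normr_rnorm ltcR.
rewrite -ler_sqr ?nnegrE ?rnorm_ge0// (yE' J' uJ'); last first.
  by move=> k ks; apply: sJ'; rewrite mem_undup.
by rewrite (fourier_sum_best c' x uJ') lerDl sqr_ge0.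
Qed.

(** Parseval on a finite J that nearly exhausts y, then Bessel for z. This comparison replaces
    explicit series of squared coefficients. *)
Lemma rnorm_dominated C y z : 0 <= C ->
  (forall k, rnorm (dot y (psi k) : R[i]^o) <= C * rnorm (dot z (psi k) : R[i]^o)) ->
  rnorm y <= C * rnorm z.
Proof.
move=> C0 yz; apply/ler_addgt0Pr => e e0; have [J uJ HJ] := fourier_dense y e0.
have := HJ J uJ (fun _ => id).
have : rnorm (fourier_sum J (coef y)) <= C * rnorm z.
  rewrite (@le_trans _ _ (C * rnorm (fourier_sum J (coef z))))//; last first.
    by rewrite ler_wpM2l// bessel.
  rewrite -ler_sqr ?nnegrE ?mulr_ge0 ?rnorm_ge0// exprMn !rnorm_fourier_sum// mulr_sumr.
  apply: ler_sum => k _; rewrite -exprMn ler_sqr ?nnegrE ?mulr_ge0 ?rnorm_ge0//.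
  exact: yz.
have := rnormD (y - fourier_sum J (coef y)) (fourier_sum J (coef y)); rewrite subrK; lra.
Qed.

Lemma coef_inj y z : (forall k, dot y (psi k) = dot z (psi k)) -> y = z.
Proof.
move=> yz; apply/eqP; rewrite -subr_eq0; apply/eqP/rnorm_eq0/eqP.
rewrite eq_le rnorm_ge0 andbT -(mul0r (rnorm (0 : H))); apply: rnorm_dominated => // k.
by rewrite linearBl /= yz subrr rnorm0 mul0r.
Qed.

(** Riesz-Fischer in dominated form: the tails of the sums of c k *: psi k are bounded by C times
    the Fourier remainders of x, so the net of finite sums is Cauchy and converges by
    completeness. *)
Lemma coef_exists C x (c : I -> R[i]) : 0 <= C ->
  (forall k, rnorm (c k : R[i]^o) <= C * rnorm (dot x (psi k) : R[i]^o)) ->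
  exists y, forall k, dot y (psi k) = c k.
Proof.
move=> C0 cx.
pose S (A : {fset I}) := fourier_sum A c.
have SJ (A B : {fset I}) : {subset B <= A} ->
    rnorm (S B - S A) <= C * rnorm (x - fourier_sum B (coef x)).
  move=> BA; apply: rnorm_dominated => // k; rewrite !linearBl /= !coef_fourier_sum ?fset_uniq//.
  have [kB|kB] := boolP (k \in B); first by rewrite (BA _ kB) subrr rnorm0 mulr_ge0 ?rnorm_ge0.
  rewrite sub0r rnormN subr0; case: ifP => _; first exact: cx.
  by rewrite rnorm0 mulr_ge0 ?rnorm_ge0.
have FF : ProperFilter (S @ totally) by apply: fmap_proper_filter; exact: totally_filter.
have cS : cauchy (S @ totally).
  apply: cauchy_exP => e /gt0_complexE[-> e0].
  have C1 : 0 < C + 1 by rewrite ltr_wpDl.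
  have [J uJ HJ] := fourier_dense x (divr_gt0 e0 C1).
  pose J0 : {fset I} := [fset k in J]%fset.
  exists (S J0); exists J0 => // A1 /= /fsubsetP J0A.
  rewrite -ball_normE /ball_ /= normr_rnorm ltcR (le_lt_trans (SJ _ _ J0A))//.
  have : rnorm (x - fourier_sum J0 (coef x)) < complex.Re e / (C + 1).
    by apply: HJ => [|k kJ]; rewrite ?fset_uniq// !inE.
  rewrite ltr_pdivlMr//; have := rnorm_ge0 (x - fourier_sum J0 (coef x)); nra.
have [y Sy] : exists y, S @ totally --> y by apply/cvg_ex; exact: cauchy_cvg.
exists y => k.
have c1 : (dot (S A) (psi k) : R[i]^o) @[A --> totally] --> (dot y (psi k) : R[i]^o).
  exact: (cvg_dotl (f := S)) Sy.
have c2 : (dot (S A) (psi k) : R[i]^o) @[A --> totally] --> (c k : R[i]^o).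
  apply: cvg_near_cst; exists [fset k]%fset => // A /=; rewrite fsub1set => kA.
  by rewrite coef_fourier_sum ?fset_uniq// kA.
exact: (cvg_unique _ c1 c2).
Qed.

Lemma cvg_fourier x : partial_sum (fun k => dot x (psi k) *: psi k) @ totally --> x.
Proof.
apply/cvg_rnormP => e e0; have [J uJ HJ] := fourier_dense x e0.
exists [fset k in J]%fset => // A /= /fsubsetP JA.
rewrite /partial_sum -(big_seq_fsetE _ _ xpredT (fun k => dot x (psi k) *: psi k)).
by apply: HJ => [|k kJ]; [exact: fset_uniq|apply: JA; rewrite !inE].
Qed.

End basis.
End hilbert.

(** * Functional calculus *)

Section spectral.
Context {R : realType} {H : completeNormedModType R[i]}.
Variable dot : {dot H for @Num.conj R[i]}.
Hypothesis H_hilbert : forall x : H, `|x| ^+ 2 = dot x x.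
Variable A : unbounded_op H.
Hypothesis A_self_adjoint : self_adjoint dot A.
Context {I : countType} (lambda : I -> R) (psi : I -> H).
Hypothesis lambda_gt0 : forall k, 0 < lambda k.
Hypothesis psi_basis : orthonormal_basis dot psi.
Hypothesis psi_eigen : forall k,
  dom A (psi k) /\ A (psi k) = (lambda k ^+ 2)%:C *: psi k.

Let coef x : I -> R[i] := fun k => dot x (psi k).

Lemma conj_real (r : R) : Num.conj (r%:C : R[i]) = r%:C.
Proof. by apply/conj_Creal/complex_realP; exists r. Qed.

Lemma dot_op_eigenvector x k : dom A x ->
  dot (A x) (psi k) = (lambda k ^+ 2)%:C * dot x (psi k).
Proof.
have [_ /(_ (psi k) ((lambda k ^+ 2)%:C *: psi k)) [_ adj]] := A_self_adjoint.
move=> /(adj (psi_eigen k)) ->; by rewrite linearZr_LR /= conj_real.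
Qed.

Lemma dot_fourier x y : partial_sum (fun k => Num.conj (dot y (psi k)) * dot x (psi k) : R[i]^o)
  @ totally --> (dot x y : R[i]^o).
Proof.
have c : (dot x (partial_sum (fun k => dot y (psi k) *: psi k) J) : R[i]^o)
    @[J --> totally] --> (dot x y : R[i]^o).
  exact: (cvg_dotr H_hilbert (cvg_fourier H_hilbert psi_basis (x := y))).
apply: (cvg_near_eq c); apply: nearW => J.
rewrite /partial_sum linear_sumr; apply: eq_bigr => k _.
by rewrite linearZr_LR.
Qed.

Lemma dot_eq_of_coef x y x' y' :
  (forall k, Num.conj (dot y (psi k)) * dot x (psi k) =
             Num.conj (dot y' (psi k)) * dot x' (psi k)) -> dot x y = dot x' y'.
Proof.
move=> E; have c : partial_sum (fun k => Num.conj (dot y (psi k)) * dot x (psi k) : R[i]^o)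
    @ totally --> (dot x' y' : R[i]^o).
  rewrite (_ : (fun k => _) = (fun k => Num.conj (dot y' (psi k)) * dot x' (psi k) : R[i]^o)).
    exact: dot_fourier.
  by apply/funext.
exact: (cvg_unique _ (@dot_fourier x y) c).
Qed.

Lemma eigenspace_coef (mu : R) z k : eigenspace_op A mu%:C z ->
  lambda k ^+ 2 != mu -> dot z (psi k) = 0.
Proof.
move=> [dz Az] lmu; have := dot_op_eigenvector k dz; rewrite Az linearZl_LR /=.
move/eqP; rewrite -subr_eq0 -mulrBl mulf_eq0 => /orP[|/eqP//].
by rewrite subr_eq0 => /eqP/complexI E; rewrite E eqxx in lmu.
Qed.

(** y may be an infinite combination, so membership in dom A is not a matter of linearity: Parseval
    verifies the adjoint relation with mu y, and self-adjointness puts y in the domain. *)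
Lemma coef_eigenspace (mu : R) y :
  (forall k, lambda k ^+ 2 != mu -> dot y (psi k) = 0) -> eigenspace_op A mu%:C y.
Proof.
move=> y0; have [_ /(_ y (mu%:C *: y)) [+ _]] := A_self_adjoint; apply.
move=> x dx; apply: dot_eq_of_coef => k.
rewrite dot_op_eigenvector// linearZl_LR /= (rmorphM (@Num.conj R[i])) /= conj_real.
have [->|/y0 ->] := eqVneq (lambda k ^+ 2) mu; first by ring.
by rewrite rmorph0 !(mul0r, mulr0).
Qed.

(** Keeping the coefficients of x with eigenvalue mu gives a vector with the defining property, so
    the default of [xget] is not what fixes the value; any vector with that property has these
    coefficients. *)
Lemma eigenproj_coef (mu : R) x k : dot (eigenproj dot A mu x) (psi k) =
  if lambda k ^+ 2 == mu then dot x (psi k) else 0.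
Proof.
rewrite /eigenproj; set P := [set y | _].
have [y yx] : exists y, forall k, dot y (psi k) = if lambda k ^+ 2 == mu then dot x (psi k) else 0.
  apply: (coef_exists H_hilbert psi_basis (C := 1) (x := x)) => // j; rewrite mul1r.
  by case: ifP => // _; rewrite rnorm0 rnorm_ge0.
have Py : P y.
  split; first by apply: coef_eigenspace => j /negPf jmu; rewrite yx jmu.
  move=> z ze; rewrite -(linear0l dot z) //; apply: dot_eq_of_coef => j.
  rewrite linear0l mulr0 linearBl /= yx; case: eqP => [_|/eqP jmu].
    by rewrite subrr mulr0.
  by rewrite (eigenspace_coef ze jmu) rmorph0 mul0r.
have [Pe Po] : P (xget 0 P) by apply: xgetPex; exists y.
case: eqP => [lmu|/eqP lmu]; last exact: eigenspace_coef Pe lmu.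
apply/esym/eqP; rewrite -subr_eq0 -linearBl /=; apply/eqP/Po.
by have [dk Ak] := psi_eigen k; split => //; rewrite Ak lmu.
Qed.

(** The sum runs over real numbers mu, while several indices k may share one eigenvalue. Once M
    contains the eigenvalues of all k in J, the missing coefficients have indices outside J, and the
    error is at most C times the Fourier remainder of x over J. *)
Lemma functional_calculus_cvg (f : R -> R[i]) (C : R) x y : 0 <= C ->
  (forall k, rnorm (f (lambda k ^+ 2) : R[i]^o) <= C) ->
  (forall k, dot y (psi k) = f (lambda k ^+ 2) * dot x (psi k)) ->
  functional_calculus dot A f x = y.
Proof.
move=> C0 fC yf; apply: (cvg_lim (@norm_hausdorff _ _)).
apply/cvg_rnormP => e e0; have C1 : 0 < C + 1 by rewrite ltr_wpDl.
have [J uJ HJ] := fourier_dense H_hilbert psi_basis x (divr_gt0 e0 C1).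
exists [fset lambda k ^+ 2 | k in J]%fset => // M /= /fsubsetP JM.
apply: (@le_lt_trans _ _ (C * rnorm (x - fourier_sum psi J (coef x)))).
  apply: (rnorm_dominated H_hilbert psi_basis) => // k; rewrite !linearBl /=.
  have -> : dot (partial_sum (fun m => f m *: eigenproj dot A m x) M) (psi k) =
      if lambda k ^+ 2 \in M then f (lambda k ^+ 2) * dot x (psi k) else 0.
    rewrite /partial_sum -(big_seq_fsetE _ _ xpredT (fun m => f m *: eigenproj dot A m x)).
    rewrite linear_sumlz; under eq_bigr do rewrite /= linearZl_LR /= eigenproj_coef.
    case: ifPn => kM; last first.
      rewrite big1_seq// => m /andP[_ mM]; case: eqP => [km|_]; last by rewrite mulr0.
      by rewrite km mM in kM.
    rewrite (bigD1_seq (lambda k ^+ 2)) ?fset_uniq//= eqxx big1 ?addr0// => m.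
    by rewrite eq_sym => /negPf ->; rewrite mulr0.
  rewrite yf coef_fourier_sum//.
  case: ifPn => kM; first by rewrite subrr rnorm0 mulr_ge0// rnorm_ge0.
  rewrite ifN ?subr0; last first.
    by apply: contra kM => kJ; apply: JM; apply/imfsetP; exists k.
  by rewrite (rnormZ (V := R[i]^o)) ler_wpM2r ?rnorm_ge0.
move: (HJ J uJ (fun _ => id)); rewrite ltr_pdivlMr//.
by have := rnorm_ge0 (x - fourier_sum psi J (coef x)); nra.
Qed.

Lemma functional_calculus_coef (f : R -> R[i]) (C : R) x k : 0 <= C ->
  (forall k, rnorm (f (lambda k ^+ 2) : R[i]^o) <= C) ->
  dot (functional_calculus dot A f x) (psi k) = f (lambda k ^+ 2) * dot x (psi k).
Proof.
move=> C0 fC.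
have [y yf] : exists y, forall k, dot y (psi k) = f (lambda k ^+ 2) * dot x (psi k).
  apply: (coef_exists H_hilbert psi_basis (C := C) (x := x)) => // j.
  by rewrite (rnormZ (V := R[i]^o)) ler_wpM2r ?rnorm_ge0.
by rewrite (functional_calculus_cvg C0 fC yf).
Qed.

(** The resolvent S at 0 inverts A, so S (psi k) = lambda_k^(-2) psi k. By continuity S maps a ball
    of radius d into the unit ball; testing on (d / 2) psi k gives lambda_k^(-2) < 2 / d. *)
Lemma eigenvalue_inv_bounded : ~ spectrum A 0 ->
  exists2 M, 0 <= M & forall k, (lambda k)^-1 <= M.
Proof.
move=> /contrapT [S [cS _ SA]].
have c0 : S x @[x --> (0 : H)] --> S 0 by exact: cS.
have /cvg_rnormP /(_ 1 ltr01) /nbhs_ballP [e /gt0_complexE[-> d0] Hd] := c0.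
set d := complex.Re e in d0 Hd.
(* A bound on x itself, drawn from x ^ 2 < 2 / d by x <= 1 + x ^ 2. *)
exists (1 + 2 / d); first by rewrite addr_ge0// divr_ge0// ltW.
move=> k; have npsi := rnorm_basis H_hilbert psi_basis k.
have SE : (lambda k ^+ 2)%:C *: S (psi k) = psi k.
  have [dk Ak] := psi_eigen k; have := SA _ dk; rewrite scale0r subr0 Ak => {2}<-.
  by rewrite linearZ.
have : rnorm (S 0 - S ((d / 2)%:C *: psi k)) < 1.
  apply: Hd; rewrite -ball_normE /ball_ /= sub0r normrN normr_rnorm ltcR rnormZr npsi.
  by rewrite mulr1 ger0_norm; lra.
rewrite linear0 sub0r rnormN linearZ rnormZr => H1.
have E : lambda k ^+ 2 * rnorm (S (psi k)) = 1.
  by rewrite -npsi -{2}SE rnormZr ger0_norm// sqr_ge0.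
have l0 := lambda_gt0 k.
have rE : rnorm (S (psi k)) = (lambda k)^-1 ^+ 2.
  by rewrite exprVn -[RHS]mulr1 -E mulKf// expf_neq0// gt_eqF.
move: H1; rewrite rE ger0_norm; last by lra.
rewrite mulrAC ltr_pdivrMr// mul1r => H1.
have : (lambda k)^-1 ^+ 2 < 2 / d by rewrite ltr_pdivlMr// mulrC.
nra.
Qed.

End spectral.

(** * Approximation by step functions *)

Section trunc.
Context {R : realType}.
Implicit Types (y : R) (z : R[i]).

(** For y >= 0 this is the minimum of M and the integer part of y, written as a sum of indicators of
    superlevel sets so that it becomes a step function. *)
Let count (M : nat) y : R := \sum_(j < M) (j.+1%:R <= y)%R%:R.

Let countP M y : (M%:R <= y -> count M y = M%:R) /\ (y < M%:R -> 0 <= y ->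
  count M y <= y < count M y + 1).
Proof.
elim: M => [|M [IH1 IH2]].
  rewrite /count big_ord0; split => // y0 y1; move: y0; rewrite ltNge y1 //.
rewrite /count big_ord_recr /= -/(count M y); split => [My|yM y0].
  have My' : M%:R <= y by apply: le_trans My; rewrite ler_nat.
  by rewrite IH1// My -natr1.
rewrite [M.+1%:R <= y]leNgt yM addr0; have [My|My] := leP M%:R y; last exact: IH2.
by rewrite IH1// My natr1.
Qed.

Let count_neg M y : y <= 0 -> count M y = 0.
Proof.
move=> y0; rewrite /count big1// => j _; rewrite leNgt (le_lt_trans y0)//.
Qed.

(** Rounds y >= 0 down to a multiple of 1 / (n + 1), capped at n + 1: hence (n + 1) ^ 2 levels.
    Negative numbers go to 0. *)
Let Q (n : nat) y : R := (n.+1%:R)^-1 * \sum_(j < n.+1 ^ 2) (j.+1%:R / n.+1%:R <= y)%R%:R.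

Let QE n y : Q n y = (n.+1%:R)^-1 * count (n.+1 ^ 2) (n.+1%:R * y).
Proof.
congr (_ * _); apply: eq_bigr => j _.
by rewrite ler_pdivrMr ?ltr0n// [y * _]mulrC.
Qed.

Let Q_neg n y : y <= 0 -> Q n y = 0.
Proof.
by move=> y0; rewrite QE count_neg ?mulr0// mulr_ge0_le0.
Qed.

Let Q_bound n y : 0 <= y -> 0 <= Q n y <= y.
Proof.
move=> y0; rewrite QE mulr_ge0 ?invr_ge0//=; last by rewrite sumr_ge0.
rewrite mulrC ler_pdivrMr ?ltr0n// [y * _]mulrC.
have [H1 H2] := countP (n.+1 ^ 2) (n.+1%:R * y).
have [My|yM] := leP (n.+1 ^ 2)%:R (n.+1%:R * y); first by rewrite H1.
by have /andP[] := H2 yM (mulr_ge0 (ler0n _ _) y0).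
Qed.

Let Q_close n y : 0 <= y -> y <= n.+1%:R -> y - Q n y <= n.+1%:R^-1.
Proof.
move=> y0 yn; rewrite QE lerBlDr -[X in _ <= X + _]mulr1 -mulrDr [_^-1 * _]mulrC.
rewrite ler_pdivlMr ?ltr0n// [y * _]mulrC addrC.
have [H1 H2] := countP (n.+1 ^ 2) (n.+1%:R * y).
have [My|yM] := leP (n.+1 ^ 2)%:R (n.+1%:R * y).
  by rewrite H1// (@le_trans _ _ (n.+1 ^ 2)%:R) ?lerDl// natrX expr2 ler_wpM2l.
by have /andP[_ /ltW] := H2 yM (mulr_ge0 (ler0n _ _) y0).
Qed.

Let qs n y := Q n y - Q n (- y).

Let qs_le n y : `|qs n y| <= `|y|.
Proof.
rewrite /qs; have [y0|y0] := leP 0 y.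
  have /andP[Q0 Qy] := Q_bound n y0.
  by rewrite (Q_neg n (y := - y)) ?oppr_le0// subr0 ger0_norm// ger0_norm.
have y0' : 0 <= - y by lra.
have /andP[Q0 Qy] := Q_bound n y0'.
by rewrite (Q_neg n (ltW y0)) sub0r normrN (ger0_norm Q0) (ltr0_norm y0).
Qed.

Let qs_close n y : `|y| <= n.+1%:R -> `|y - qs n y| <= n.+1%:R^-1.
Proof.
rewrite /qs; have [y0|y0] := leP 0 y => yn.
  have /andP[Q0 Qy] := Q_bound n y0.
  rewrite (Q_neg n (y := - y)) ?oppr_le0// subr0 ger0_norm ?subr_ge0//.
  by apply: Q_close => //; rewrite ger0_norm in yn.
have y0' : 0 <= - y by lra.
have /andP[Q0 Qy] := Q_bound n y0'.
rewrite (Q_neg n (ltW y0)) sub0r opprK.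
have yQ : y + Q n (- y) <= 0 by rewrite addrC -lerBrDr sub0r.
rewrite (ler0_norm yQ).
move: yn; rewrite ltr0_norm// => yn.
by rewrite opprD; exact: Q_close.
Qed.

(** Rounds the real and imaginary parts towards 0 on the grid of mesh 1 / (n + 1). Adding the two
    parts is the origin of the factor 2 in the bounds below. *)
Definition dyadic_trunc n z : R[i] :=
  (qs n (complex.Re z))%:C + 'i * (qs n (complex.Im z))%:C.

Let Re_trunc n z : complex.Re (dyadic_trunc n z) = qs n (complex.Re z).
Proof. by rewrite /dyadic_trunc /= !(mul0r, mul1r, mulr0, subr0, addr0). Qed.

Let Im_trunc n z : complex.Im (dyadic_trunc n z) = qs n (complex.Im z).
Proof. by rewrite /dyadic_trunc /= !(mul0r, mul1r, mulr0, addr0, add0r). Qed.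

Lemma dyadic_trunc_le n z : rnorm (dyadic_trunc n z : R[i]^o) <= 2 * rnorm (z : R[i]^o).
Proof.
rewrite (le_trans (rnorm_le_ReIm _))// Re_trunc Im_trunc.
rewrite mulr_natl mulr2n lerD//.
  exact: le_trans (qs_le n _) (Re_le_rnorm z).
exact: le_trans (qs_le n _) (Im_le_rnorm z).
Qed.

Lemma dyadic_trunc_close n z : rnorm (z : R[i]^o) <= n.+1%:R ->
  rnorm (z - dyadic_trunc n z : R[i]^o) <= 2 / n.+1%:R.
Proof.
move=> zn; rewrite (le_trans (rnorm_le_ReIm _))//.
have -> : complex.Re (z - dyadic_trunc n z) = complex.Re z - qs n (complex.Re z).
  by rewrite -Re_trunc; case: z {zn} => a b; case: (dyadic_trunc _ _).
have -> : complex.Im (z - dyadic_trunc n z) = complex.Im z - qs n (complex.Im z).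
  by rewrite -Im_trunc; case: z {zn} => a b; case: (dyadic_trunc _ _).
rewrite mulr_natl mulr2n lerD//; apply: qs_close.
  exact: le_trans (Re_le_rnorm z) zn.
exact: le_trans (Im_le_rnorm z) zn.
Qed.

Section steps.
Context {V : normedModType R[i]}.
Implicit Types (E D : set (measurableTypeR R)) (p : R -> R) (w : V).

Definition level_steps E p n w : seq (set R * V) :=
  [seq (E `&` [set x | j.+1%:R / n.+1%:R <= p x], (n.+1%:R^-1)%:C *: w)
  | j <- index_iota 0 (n.+1 ^ 2)].

Lemma step_level_steps E p n w x : E x ->
  step (level_steps E p n w) x = (Q n (p x))%:C *: w.
Proof.
move=> Ex; rewrite /step big_map big_mkord /Q rmorphM /= rmorph_sum /= mulr_sumr scaler_suml.
apply: eq_bigr => j _; rewrite scalerA mulrC indicE; congr (_ * _ *: _); congr (_%:C).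
have -> : (x \in E `&` [set x0 | j.+1%:R / n.+1%:R <= p x0]) = (j.+1%:R / n.+1%:R <= p x).
  by apply/idP/idP => [|jx]; rewrite inE => // -[].
by [].
Qed.

Lemma level_steps_on E D p n w : measurable E -> E `<=` D ->
  mu.-integrable E (EFin \o p) -> step_on D (level_steps E p n w).
Proof.
move=> mE ED ip q /mapP[j _ ->] /=.
have mp : measurable_fun E p by have /integrableP[/measurable_EFinP] := ip.
(* The levels start at j + 1, so c is positive and Markov's inequality makes the superlevel set of
   finite measure, even when E has infinite measure. *)
set c := j.+1%:R / n.+1%:R; have c0 : 0 < c by rewrite divr_gt0 ?ltr0n.
pose A : set (measurableTypeR R) := E `&` [set x | c <= p x].
have mA : measurable A.
  rewrite /A (_ : [set x | c <= p x] = p @^-1` `[c, +oo[); first exact: mp.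
  by apply/seteqP; split => y /=; rewrite in_itv/= andbT.
split => //; first by move=> y [/ED].
have le1 : (c%:E * mu A <= \int[mu]_(x in A) `|(p x)%:E|)%E.
  rewrite -integral_cst//; apply: ge0_le_integral => //.
  - by move=> x _; rewrite lee_fin ltW.
  - apply: measurableT_comp => //; apply/measurable_EFinP.
    by apply: measurable_funS mp => // y [].
  - by move=> x [_ /= cp]; rewrite lee_fin (le_trans cp)// ler_norm.
have le2 : (\int[mu]_(x in A) `|(p x)%:E| <= \int[mu]_(x in E) `|(p x)%:E|)%E.
  apply: ge0_subset_integral => //; last by move=> y [].
  by apply: measurableT_comp => //; exact/measurable_EFinP.
have : (c%:E * mu A < +oo)%E.
  apply: le_lt_trans le1 _; apply: le_lt_trans le2 _.
  by have /integrableP[] := ip.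
rewrite !ltey; apply: contra => /eqP ->.
by rewrite gt0_muley// lte_fin.
Qed.

(** As Q vanishes on negative numbers, each of the four lists takes care of one sign of the real or
    of the imaginary part. *)
Definition complex_steps E (f : R -> R[i]) n w : seq (set R * V) :=
  level_steps E (fun x => complex.Re (f x)) n w ++
  level_steps E (fun x => - complex.Re (f x)) n (- w) ++
  level_steps E (fun x => complex.Im (f x)) n ('i *: w) ++
  level_steps E (fun x => - complex.Im (f x)) n (- ('i *: w)).

Lemma step_complex_steps E f n w x : E x ->
  step (complex_steps E f n w) x = dyadic_trunc n (f x) *: w.
Proof.
move=> Ex; rewrite /complex_steps !step_cat !step_level_steps// /dyadic_trunc /qs !rmorphB /=.
rewrite !scalerN !scalerA mulrBr !scalerDl !scaleNr -!addrA.
by rewrite [(Q n (complex.Im _))%:C * 'i]mulrC [_ * 'i]mulrC.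
Qed.

Lemma complex_steps_on E D f n w : measurable E -> E `<=` D ->
  mu.-integrable E (EFin \o (fun x => complex.Re (f x))) ->
  mu.-integrable E (EFin \o (fun x => complex.Im (f x))) ->
  step_on D (complex_steps E f n w).
Proof.
move=> mE ED ir ii q; rewrite !mem_cat => /or4P[].
- exact: level_steps_on.
- by apply: level_steps_on => //; have := integrableN ir.
- exact: level_steps_on.
- by apply: level_steps_on => //; have := integrableN ii.
Qed.

End steps.

End trunc.

(** * Existence of Bochner integrals in a Hilbert space *)

Section hilbert_bochner.
Context {R : realType} {H : completeNormedModType R[i]}.
Variable dot : {dot H for @Num.conj R[i]}.
Hypothesis H_hilbert : forall x : H, `|x| ^+ 2 = dot x x.
Implicit Types (D E N : set (measurableTypeR R)) (s : seq (set R * H)).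

Lemma dot_real_bounded (c : R[i] -> R) y : real_bounded (c : R[i]^o -> R) 1 ->
  real_bounded (fun x => c (dot x y)) (rnorm y).
Proof.
move=> [_ cD cZ cK]; split; first exact: rnorm_ge0.
- by move=> a b; rewrite linearDl cD.
- by move=> r a; rewrite linearZl_LR; exact: cZ.
- move=> a; rewrite (le_trans (cK _))// mul1r mulrC; exact: cauchy_schwarz.
Qed.

(* By duality: pair the integral with itself. *)
Lemma rnorm_step_integral D s : measurable D -> step_on D s ->
  rnorm (step_integral s) <= \int[mu]_(x in D) rnorm (step s x).
Proof.
move=> mD sD; set w := step_integral s.
have irs : mu.-integrable D (EFin \o (fun x => rnorm (step s x))).
  by apply: (@integrableS _ _ _ _ setT) => //; exact: integrable_rnorm_step sD.
have [->|w0] := eqVneq w 0.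
  by rewrite rnorm0; apply: Rintegral_ge0 => x _; exact: rnorm_ge0.
have nw0 : 0 < rnorm w.
  by rewrite lt_def rnorm_ge0 andbT; apply: contra w0 => /eqP /rnorm_eq0 ->.
rewrite -(ler_pM2l nw0) -expr2.
have -> : rnorm w ^+ 2 = complex.Re (dot w w) by rewrite (dot_rnorm H_hilbert).
have lb := dot_real_bounded w Re_real_bounded; have [_ _ _ lK] := lb.
rewrite (real_bounded_step_integral mD lb sD) -RintegralZl//.
apply: le_Rintegral => //.
- apply: (@integrableS _ _ _ _ setT) => //; exact: real_bounded_integrable_step lb sD.
- exact: (integrableZl mD (rnorm w) irs).
- by move=> x _; rewrite (le_trans (ler_norm _)).
Qed.

(** Two step integrals differ by at most the sum of their error integrals; they form a Cauchy
    sequence, and H is complete. *)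
Lemma bochner_integral_exists D (f : R -> H) t : measurable D -> step_approx D f t ->
  exists v, is_bochner_integral D f v.
Proof.
move=> mD tf; have [tD _ t0] := tf.
have [N [mN N0 HN]] := step_approx_null tf.
have mE : measurable (D `\` N) by exact: measurableD.
have [ift _] := integrable_rnorm_limit mD mN N0 tf HN.
pose e n := \int[mu]_(x in D `\` N) rnorm (f x - step (t n) x).
have e0 : e n @[n --> \oo] --> 0.
  have -> : 0 = fine (0%E : \bar R) by [].
  apply: fine_cvg; move: t0.
  by under eq_fun do rewrite (integral_null_setD _ mD mN N0).
have key n m : rnorm (step_integral (t n) - step_integral (t m)) <= e n + e m.
  have cD := step_onB (tD n) (tD m).
  rewrite -step_integralB (le_trans (rnorm_step_integral mD cD))//.
  rewrite /Rintegral (integral_null_setD _ mD mN N0) -/(Rintegral _ _ _) -RintegralD//.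
  apply: le_Rintegral => //.
  - by apply: (@integrableS _ _ _ _ setT) => //; exact: integrable_rnorm_step cD.
  - exact: (integrableD mE (ift n) (ift m)).
  - move=> x _; rewrite stepB rnorm_distC [rnorm (f x - step (t m) x)]rnorm_distC.
    by rewrite [leRHS]addrC -(subrKA (f x) (step (t m) x)) rnormD.
have cS : cauchy (step_integral (t n) @[n --> \oo]).
  apply: cauchy_exP => r /gt0_complexE[-> r0].
  have r2 : 0 < complex.Re r / 2 by lra.
  have /cvgrPdist_lt /(_ _ r2) [M _ HM] := e0.
  exists (step_integral (t M)); exists M => // n Mn.
  rewrite /= -ball_normE /ball_ /= normr_rnorm ltcR (le_lt_trans (key _ _))//.
  have := HM n Mn; have := HM M (leqnn M); rewrite /= !sub0r !normrN => hM hn.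
  have := ler_norm (e n); have := ler_norm (e M); lra.
have [v Sv] : exists v : H, step_integral (t n) @[n --> \oo] --> v.
  by exists (lim (step_integral (t n) @[n --> \oo])); apply: cauchy_cvg cS.
by exists v; exists t.
Qed.

Section approx.
Context {I : countType} (psi : I -> H).
Hypothesis psi_basis : orthonormal_basis dot psi.
Variables (D N : set (measurableTypeR R)) (g : R -> H) (B : R -> R).
Hypotheses (mD : measurable D) (mN : measurable N) (N0 : mu N = 0%E).
Hypothesis iB : mu.-integrable (D `\` N) (EFin \o B).
Hypothesis gB : forall x, (D `\` N) x -> rnorm (g x) <= B x.
Hypothesis mRe : forall k, measurable_fun (D `\` N) (fun x => complex.Re (dot (g x) (psi k))).
Hypothesis mIm : forall k, measurable_fun (D `\` N) (fun x => complex.Im (dot (g x) (psi k))).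

(** The indices with code below n: finite sets that exhaust the countable type I. *)
Let J (n : nat) : seq I := undup (pmap (@choice.unpickle I) (iota 0 n)).

Let mem_J k n : (choice.pickle k < n)%N -> k \in J n.
Proof.
move=> kn; rewrite mem_undup mem_pmap; apply/mapP; exists (choice.pickle k).
  by rewrite mem_iota.
by rewrite choice.pickleK.
Qed.

Let uJ n : uniq (J n). Proof. exact: undup_uniq. Qed.

Let t n : seq (set R * H) :=
  flatten [seq complex_steps (D `\` N) (fun x => dot (g x) (psi k)) n (psi k) | k <- J n].

Let coef_le x k : (D `\` N) x -> rnorm (dot (g x) (psi k) : R[i]^o) <= B x.
Proof.
move=> xE; rewrite (le_trans (cauchy_schwarz H_hilbert _ _))//.
by rewrite (rnorm_basis H_hilbert psi_basis) mulr1 gB.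
Qed.

Let t_on n : step_on D (t n).
Proof.
have mE : measurable (D `\` N) by exact: measurableD.
move=> q /flattenP[s /mapP[k _ ->]]; apply: complex_steps_on => //.
- apply: le_integrable iB => //; first by apply/measurable_EFinP; exact: mRe.
  move=> x xE; rewrite /= lee_fin (le_trans (Re_le_rnorm _))// (le_trans (coef_le k xE))//.
  exact: ler_norm.
- apply: le_integrable iB => //; first by apply/measurable_EFinP; exact: mIm.
  move=> x xE; rewrite /= lee_fin (le_trans (Im_le_rnorm _))// (le_trans (coef_le k xE))//.
  exact: ler_norm.
Qed.

Let step_t n x : (D `\` N) x ->
  step (t n) x = fourier_sum psi (J n) (fun k => dyadic_trunc n (dot (g x) (psi k))).
Proof.
move=> xE; rewrite /t /fourier_sum; elim: (J n) => [|k s IH].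
  by rewrite big_nil step_nil.
rewrite map_cons -[flatten (_ :: _)]/(_ ++ flatten _) step_cat IH big_cons; congr (_ + _).
exact: step_complex_steps.
Qed.

Let step_t_coef_le n x k : (D `\` N) x ->
  rnorm (dot (step (t n) x) (psi k) : R[i]^o) <= 2 * rnorm (dot (g x) (psi k) : R[i]^o).
Proof.
move=> xE; rewrite step_t// (coef_fourier_sum psi_basis)//.
case: ifP => _; first exact: dyadic_trunc_le.
by rewrite rnorm0 mulr_ge0// rnorm_ge0.
Qed.

(* Split off the finitely many coordinates carrying g x up to e: there the
   truncations converge, elsewhere they are dominated by the coordinates of g x. *)
Let step_t_cvg x : (D `\` N) x -> step (t n) x @[n --> \oo] --> g x.
Proof.
move=> xE; apply/cvg_rnormP => e e0.
(* The remainder will cost 3 times rnorm d, that is e / 2; the coordinates in F take the other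
   half. *)
have e6 : 0 < e / 6 by lra.
have [F uF HF] := fourier_dense H_hilbert psi_basis (g x) e6.
pose d := g x - fourier_sum psi F (fun k => dot (g x) (psi k)).
have d6 : rnorm d < e / 6 by exact: HF.
have small : (size F)%:R * (2 / n.+1%:R) @[n --> \oo] --> (0 : R).
  rewrite -(mulr0 (size F)%:R); apply: cvgM; first exact: cvg_cst.
  rewrite -(mulr0 2); apply: cvgM; first exact: cvg_cst.
  exact: cvg_harmonic.
have e2 : 0 < e / 2 by lra.
near=> n.
have FJ k : k \in F -> k \in J n.
  move=> kF; apply: mem_J.
  suff H' : (\max_(k <- F) (choice.pickle k).+1 <= n)%N.
    by apply: leq_trans H'; rewrite (big_rem k)//= leq_max leqnn.
  by near: n; exact: nbhs_infty_ge.
have Bn : B x <= n.+1%:R.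
  have : (Num.truncn (B x)).+1%:R <= n%:R :> R.
    by rewrite ler_nat; near: n; exact: nbhs_infty_ge.
  have := truncnS_gt (B x); rewrite -[n.+1%:R]natr1; lra.
pose a := fourier_sum psi F (fun k => dot (g x) (psi k) - dyadic_trunc n (dot (g x) (psi k))).
have na : rnorm a <= (size F)%:R * (2 / n.+1%:R).
  rewrite (le_trans (rnorm_sum _ _))//.
  have -> : (size F)%:R * (2 / n.+1%:R) = \sum_(k <- F) (2 / n.+1%:R) :> R.
    by rewrite big_const_seq count_predT iter_addr_0 mulr_natl.
  apply: ler_sum => k _; rewrite rnormZ (rnorm_basis H_hilbert psi_basis) mulr1.
  by apply: dyadic_trunc_close; rewrite (le_trans (coef_le k xE)).
(* On F the coefficients cancel. Off F they are z or z minus its truncation, where z is a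
   coefficient of d; the truncation is at most 2 |z|, whence 3 = 1 + 2. *)
have nb : rnorm (g x - step (t n) x - a) <= 3 * rnorm d.
  apply: (rnorm_dominated H_hilbert psi_basis) => // k.
  rewrite !linearBl /= step_t// /a !(coef_fourier_sum psi_basis)//.
  have [kF|kF] := boolP (k \in F).
    by rewrite FJ// !subrr rnorm0 mulr_ge0// rnorm_ge0.
  rewrite !subr0; case: ifP => _.
    rewrite (le_trans (rnormB _ _))//.
    by have := dyadic_trunc_le n (dot (g x) (psi k)); lra.
  by rewrite subr0 ler_peMl ?rnorm_ge0// ler1n.
have sm : (size F)%:R * (2 / n.+1%:R) < e / 2.
  near: n; move/cvgrPdist_lt : small => /(_ _ e2); apply: filterS => m.
  by rewrite sub0r normrN => /(le_lt_trans (ler_norm _)).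
have na' := le_lt_trans na sm.
have := rnormD (g x - step (t n) x - a) a; rewrite subrK => /le_lt_trans; apply.
rewrite (_ : e = e / 2 + e / 2); last by lra.
apply: ler_ltD na'; rewrite (le_trans nb)//; lra.
Unshelve. all: by end_near. Qed.

(** A form of Pettis' theorem: measurable coefficients and an integrable bound on the norm suffice
    for Bochner integrability. The steps are themselves dominated by 2 B, coefficient by
    coefficient. *)
Lemma hilbert_step_approx : exists s : nat -> seq (set R * H), step_approx D g s.
Proof.
have mE : measurable (D `\` N) by exact: measurableD.
exists t; apply: (step_approx_of_dominated mD mN N0 t_on step_t_cvg (integrableZl mE 2 iB)).
move=> n x xE; rewrite (@le_trans _ _ (2 * rnorm (g x)))//; last by rewrite ler_wpM2l// gB.
apply: (rnorm_dominated H_hilbert psi_basis) => // k.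
exact: step_t_coef_le.
Qed.

End approx.

End hilbert_bochner.

(** * The wave equation *)

Section wave.
Context {R : realType} {H : completeNormedModType R[i]}.
Variable dot : {dot H for @Num.conj R[i]}.
Hypothesis H_hilbert : forall x : H, `|x| ^+ 2 = dot x x.
Variable A : unbounded_op H.
Hypothesis A_self_adjoint : self_adjoint dot A.
Context {I : countType} (lambda : I -> R) (psi : I -> H).
Hypothesis lambda_gt0 : forall k, 0 < lambda k.
Hypothesis psi_basis : orthonormal_basis dot psi.
Hypothesis psi_eigen : forall k,
  dom A (psi k) /\ A (psi k) = (lambda k ^+ 2)%:C *: psi k.
Variables u ut alpha : R -> H.
Hypothesis u_solves : wave_solution dot A u ut alpha.
Hypothesis u_lim : `|u t| @[t --> +oo%R] --> (0 : R[i]^o).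
Hypothesis ut_lim : `|ut t| @[t --> +oo%R] --> (0 : R[i]^o).

Lemma has_deriv_rderiv {V : normedModType R[i]} (l : V -> R) K f (t : R) y :
  real_bounded l K -> has_deriv_on_Rplus f t y -> rderiv (l \o f) t (l y).
Proof.
move=> lb fy; have [_ lD lZ _] := lb.
apply: (cvg_near_eq (cvg_real_bounded lb fy)); apply: nearW => s /=.
by rewrite lZ (real_boundedB _ _ lb) mulrC.
Qed.

Lemma norm_cvg0_rnorm (f : R -> H) (l : H -> R) K : real_bounded l K ->
  `|f t| @[t --> +oo%R] --> (0 : R[i]^o) -> l (f t) @[t --> +oo%R] --> 0.
Proof.
move=> lb f0; rewrite -(real_bounded0 lb); apply: (cvg_real_bounded lb).
apply/cvg_rnormP => e e0; have /cvg_rnormP /(_ _ e0) := f0.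
apply: filterS => t; rewrite !sub0r !rnormN.
by rewrite /rnorm normr_id.
Qed.

Let D0 : set (measurableTypeR R) := Rplus.

Variable alpha_s : nat -> seq (set R * H).
Hypothesis alpha_approx : step_approx D0 alpha alpha_s.
Variable N : set (measurableTypeR R).
Hypotheses (mN : measurable N) (N0 : mu N = 0%E).
Hypothesis alpha_cvg : forall x, (D0 `\` N) x ->
  step (alpha_s n) x @[n --> \oo] --> alpha x.

Let mRplus : measurable D0.
Proof. exact: measurable_itv. Qed.

Let mE : measurable (D0 `\` N).
Proof. exact: measurableD. Qed.

Let i_alpha : mu.-integrable (D0 `\` N) (EFin \o (fun x => rnorm (alpha x))).
Proof. by have [] := integrable_rnorm_limit mRplus mN N0 alpha_approx alpha_cvg. Qed.

Let m_alpha l K : real_bounded l K -> measurable_fun (D0 `\` N) (fun x => l (alpha x)).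
Proof.
move=> lb; have [tD _ _] := alpha_approx.
by apply: (measurable_step_limit mE tD alpha_cvg) => w y; exact: cvg_real_bounded lb.
Qed.

Let i_coef l K : real_bounded l K ->
  mu.-integrable (D0 `\` N) (EFin \o (fun x => l (alpha x))).
Proof.
move=> lb; have [K0 _ _ lK] := lb; apply: le_integrable (integrableZl mE K i_alpha) => //.
  by apply/measurable_EFinP; exact: m_alpha lb.
by move=> x _; rewrite /= lee_fin [leRHS]ger0_norm// mulr_ge0// rnorm_ge0.
Qed.

(** c stands for the real or the imaginary part. The factor lambda_k ^ 2 is real, so the equation
    for the coefficient splits into two real scalar equations of the same form. *)
Lemma coef_duhamel (c : R[i] -> R) k t : real_bounded (c : R[i]^o -> R) 1 -> 0 <= t ->
  c (dot (u t) (psi k)) = \int[mu]_(x in `[t, +oo[)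
    ((lambda k)^-1 * sin ((t - x) * lambda k) * c (dot (alpha x) (psi k))).
Proof.
move=> cb t0; pose l x := c (dot x (psi k)).
have lb : real_bounded l (rnorm (psi k)) by exact: dot_real_bounded.
have [u_deriv ut_ac [N' [mN' N'0 HN']]] := u_solves.
have [dpsi Apsi] := psi_eigen k.
(* The coefficient of alpha is known to be measurable only off N; setting it to zero on N makes it
   integrable and alters the equation on a null set only. *)
pose a := (fun x => l (alpha x)) \_ (D0 `\` N).
have ia : mu.-integrable Rplus (EFin \o a).
  have := (integrable_mkcond _ mE).1 (i_coef lb); rewrite restrict_EFin => ia.
  by apply: (@integrableS _ _ _ _ setT) => //.
have dw : {ae mu, forall x, Rplus x ->
    rderiv (l \o ut) x (- (lambda k ^+ 2 * (l \o u) x) - a x)}.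
  exists (N' `|` N); split; [exact: measurableU|exact: null_set_setU|].
  move=> x /= Hx; apply: contrapT => /not_orP[N'x Nx]; apply: Hx => Rx.
  have [dx utx] : dom A (u x) /\ has_deriv_on_Rplus ut x (- A (u x) - alpha x).
    by apply: contrapT => Hx; apply: N'x; apply: HN' => /= /(_ Rx).
  have := has_deriv_rderiv lb utx; congr rderiv.
  rewrite (real_boundedB _ _ lb) /a patchE mem_set//; congr (_ - _).
  rewrite -[- A (u x)]sub0r (real_boundedB _ _ lb) (real_bounded0 lb) sub0r; congr (- _).
  rewrite /l (dot_op_eigenvector A_self_adjoint psi_eigen k dx).
  by have [_ _ cZ _] := cb; rewrite -cZ.
have dv x : 0 <= x -> rderiv (l \o u) x ((l \o ut) x).
  by move=> x0; apply: (has_deriv_rderiv lb); apply: u_deriv; rewrite /Rplus /= in_itv/= x0.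
have acw T : 0 < T -> ac_on 0 T (l \o ut).
  move=> T0 e e0; have [d d0 Hd] := ut_ac _ dpsi _ T0 _ e0.
  exists d => // s /andP[s1 s2] /(Hd s s1 s2); apply: le_lt_trans.
  apply: ler_sum => p _ /=; have [_ _ _ cK] := cb.
  rewrite /l -(real_boundedB (V := R[i]^o) _ _ cb).
  by rewrite (le_trans (cK _))// mul1r.
have := duhamel (lambda_gt0 k) dv acw ia dw (norm_cvg0_rnorm lb u_lim)
  (norm_cvg0_rnorm lb ut_lim) t0.
(* The true coefficient is put back in place of a. Measurability on N is not at hand, hence the
   almost everywhere comparison for arbitrary integrands. *)
rewrite /= => lu; rewrite -[LHS]/(l (u t)) lu /Rintegral; congr fine.
apply: ae_eq_integral_nonmeasurable; first exact: measurable_itv.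
exists N; split => // x /= Hx; apply: contrapT => Nx; apply: Hx.
rewrite in_itv/= andbT => tx; rewrite /a patchE mem_set//.
by split => //; rewrite /D0 /Rplus /= in_itv/= (le_trans t0 tx).
Qed.

Variable M : R.
Hypotheses (M0 : 0 <= M) (lambdaM : forall k, (lambda k)^-1 <= M).

Let sin_sqrt_le (s : R) k : rnorm (sin_sqrt s (lambda k ^+ 2) : R[i]^o) <= M.
Proof.
have l0 := lambda_gt0 k; have il0 : 0 <= (lambda k)^-1 by rewrite invr_ge0 ltW.
rewrite /sin_sqrt rnorm_real sqrtr_sqr (gtr0_norm l0) normrM (ger0_norm il0).
rewrite (le_trans _ (lambdaM k))// ler_piMr//.
by rewrite ler_norml sin_geN1 sin_le1.
Qed.

Let sin_sqrtE (s : R) k :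
  sin_sqrt s (lambda k ^+ 2) = ((lambda k)^-1 * sin (s * lambda k))%:C.
Proof. by rewrite /sin_sqrt sqrtr_sqr ger0_norm// ltW. Qed.

Let fc_coef s x k : dot (functional_calculus dot A (sin_sqrt s) x) (psi k) =
  ((lambda k)^-1 * sin (s * lambda k))%:C * dot x (psi k).
Proof.
by rewrite (functional_calculus_coef H_hilbert A_self_adjoint psi_basis psi_eigen x k M0
  (sin_sqrt_le s)) sin_sqrtE.
Qed.

Lemma wave_bochner t : 0 <= t ->
  is_bochner_integral `[t, +oo[
    (fun tau => functional_calculus dot A (sin_sqrt (t - tau)) (alpha tau)) (u t).
Proof.
move=> t0; pose g tau := functional_calculus dot A (sin_sqrt (t - tau)) (alpha tau).
pose D : set (measurableTypeR R) := `[t, +oo[%classic.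
rewrite -[X in is_bochner_integral _ X]/g -/D.
have mD : measurable D by exact: measurable_itv.
have DR : D `<=` D0.
  by move=> x; rewrite /D /D0 /Rplus /= !in_itv/= !andbT; exact: le_trans.
have mDN : measurable (D `\` N) by exact: measurableD.
have DNR : D `\` N `<=` D0 `\` N by move=> x [/DR ? ?].
have iB : mu.-integrable (D `\` N) (EFin \o (fun x => M * rnorm (alpha x))).
  have i : mu.-integrable (D `\` N) (EFin \o (fun x => rnorm (alpha x))).
    exact: (integrableS mE mDN DNR i_alpha).
  exact: (integrableZl mDN M i).
have gB x : (D `\` N) x -> rnorm (g x) <= M * rnorm (alpha x).
  move=> _; apply: (rnorm_dominated H_hilbert psi_basis) => // k.
  by rewrite fc_coef (rnormZ (V := R[i]^o)) -sin_sqrtE ler_wpM2r ?rnorm_ge0// sin_sqrt_le.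
have mS k : measurable_fun (D `\` N) (fun x : measurableTypeR R =>
    (lambda k)^-1 * sin ((t - x) * lambda k)).
  apply: (@measurable_funS _ _ _ _ setT) => //; exact: measurable_scaled_sin.
have mg (c : R[i] -> R) k : real_bounded (c : R[i]^o -> R) 1 ->
    measurable_fun (D `\` N) (fun x => c (dot (g x) (psi k))).
  move=> cb; have [_ _ cZ _] := cb.
  have lb := dot_real_bounded H_hilbert (psi k) cb.
  rewrite (_ : (fun x => _) = (fun x => ((lambda k)^-1 * sin ((t - x) * lambda k)) *
      c (dot (alpha x) (psi k)))); last first.
    by apply/funext => x; rewrite fc_coef; exact: cZ.
  apply: measurable_funM => //.
  exact: (measurable_funS mE DNR (m_alpha lb)).
have [s gs] := hilbert_step_approx H_hilbert psi_basis mD mN N0 iB gB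
  (fun k => mg _ k Re_real_bounded) (fun k => mg _ k Im_real_bounded).
have [v gv] := bochner_integral_exists H_hilbert mD gs.
suff -> : u t = v by [].
apply: (coef_inj H_hilbert psi_basis) => k; apply/eqP; rewrite -subr_eq0; apply/eqP.
have E (c : R[i] -> R) : real_bounded (c : R[i]^o -> R) 1 ->
    c (dot (u t) (psi k) - dot v (psi k)) = 0.
  move=> cb; rewrite (real_boundedB (V := R[i]^o) _ _ cb) coef_duhamel//.
  rewrite (real_bounded_bochner mD (dot_real_bounded H_hilbert (psi k) cb) gv).
  apply/eqP; rewrite subr_eq0; apply/eqP; apply: eq_Rintegral => x _.
  by rewrite fc_coef; have [_ _ cZ _] := cb; rewrite -cZ.
by rewrite [LHS]complexE (E _ Re_real_bounded) (E _ Im_real_bounded) mulr0 addr0.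
Qed.

Lemma hilbert_functionals_separate (x : H) :
  (forall l K, real_bounded l K -> l x = 0) -> x = 0.
Proof.
move=> /(_ _ _ (dot_real_bounded H_hilbert x Re_real_bounded)); rewrite (dot_rnorm H_hilbert) /=.
by move/eqP; rewrite sqrf_eq0 => /eqP/rnorm_eq0.
Qed.

(** The representation at t = 0 has sine of - tau; the sine being odd, pushing it through negation
    removes the sign. *)
Lemma wave_bochner0 : is_bochner_integral Rplus
    (fun tau => functional_calculus dot A (sin_sqrt tau) (alpha tau)) (- u 0).
Proof.
have linN : linear (fun x : H => - x) by move=> a x y; rewrite opprD scalerN.
pose T : {linear H -> H} := HB.pack (fun x : H => - x)
  (GRing.isLinear.Build _ _ _ _ (fun x : H => - x) linN).
have TK x : rnorm (T x) <= 1 * rnorm x by rewrite rnormN mul1r.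
have := is_bochner_integral_push mRplus ler01 TK (wave_bochner (lexx 0)).
congr is_bochner_integral; apply/funext => x.
apply: (coef_inj H_hilbert psi_basis) => k; rewrite /= linearNl /= !fc_coef.
by rewrite sub0r mulNr sinN mulrN rmorphN /= mulNr opprK.
Qed.

(** Push of the vector integral through x -> lambda_k (x, psi_k); the factor lambda_k cancels the
    inverse produced by A^(-1/2). *)
Lemma wave_bochner_coef0 k : is_bochner_integral Rplus
    (fun tau : R => (sin (tau * lambda k))%:C * dot (alpha tau) (psi k) : R[i]^o)
    (- ((lambda k)%:C * dot (u 0) (psi k)) : R[i]^o).
Proof.
have linT : linear (fun x : H => (lambda k)%:C * dot x (psi k) : R[i]^o).
  by move=> a x y; rewrite linearPl /= mulrDr mulrCA.
pose T : {linear H -> R[i]^o} := HB.pack (fun x : H => (lambda k)%:C * dot x (psi k) : R[i]^o)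
  (GRing.isLinear.Build _ _ _ _ (fun x : H => (lambda k)%:C * dot x (psi k) : R[i]^o) linT).
have TK x : rnorm (T x) <= lambda k * rnorm x.
  rewrite /= (rnormZr (V := R[i]^o)) (gtr0_norm (lambda_gt0 k)) ler_wpM2l ?(ltW (lambda_gt0 k))//.
  by rewrite (le_trans (cauchy_schwarz H_hilbert _ _))// (rnorm_basis H_hilbert psi_basis) mulr1.
have TE x : T x = (lambda k)%:C * dot x (psi k) by [].
rewrite (_ : - _ = T (- u 0)); last by rewrite linearN.
rewrite (_ : (fun tau => _) = T \o
    (fun tau => functional_calculus dot A (sin_sqrt tau) (alpha tau))).
  have pu := is_bochner_integral_push mRplus (ltW (lambda_gt0 k)) TK wave_bochner0.
  exact: pu.
apply/funext => x; rewrite [RHS]TE fc_coef mulrA -rmorphM mulrA mulfV ?mul1r//.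
by rewrite gt_eqF.
Qed.

End wave.

Theorem theorem5 (R : realType) (H : completeNormedModType R[i])
    (dot : {dot H for @Num.conj R[i]})
    (H_hilbert : forall x : H, `|x| ^+ 2 = dot x x)
    (H_separable : exists2 S : set H, countable S & dense S)
    (A : unbounded_op H)
    (A_self_adjoint : self_adjoint dot A)
    (A_positive : positive_op dot A)
    (I : countType) (lambda : I -> R) (psi : I -> H)
    (lambda_gt0 : forall k, 0 < lambda k)
    (A_discrete : discrete_spectrum A)
    (A_spectrum : spectrum A = range (fun k => (lambda k ^+ 2)%:C))
    (psi_basis : orthonormal_basis dot psi)
    (psi_eigen : forall k,
       dom A (psi k) /\ A (psi k) = (lambda k ^+ 2)%:C *: psi k)
    (u ut alpha : R -> H)
    (u_solves : wave_solution dot A u ut alpha)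
    (u_lim : `|u t| @[t --> +oo%R] --> (0 : R[i]^o))
    (ut_lim : `|ut t| @[t --> +oo%R] --> (0 : R[i]^o))
    (alpha_L1 : bochner_integrable Rplus alpha) :
  (* (i) *)
  (forall t, Rplus t ->
     let g tau := functional_calculus dot A (sin_sqrt (t - tau)) (alpha tau) in
     bochner_integrable `[t, +oo[ g /\
     u t = bochner_integral `[t, +oo[ g) /\
  (let g tau := functional_calculus dot A (sin_sqrt tau) (alpha tau) in
   bochner_integrable Rplus g /\ u 0 = - bochner_integral Rplus g) /\
  (* (ii) *)
  (partial_sum (fun k => dot (u 0) (psi k) *: psi k) @ totally --> u 0 /\
   forall k,
     let g tau : R[i]^o :=
       (sin (tau * lambda k))%:C * dot (alpha tau) (psi k) in
     bochner_integrable Rplus g /\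
     dot (u 0) (psi k) = - ((lambda k)^-1)%:C * bochner_integral Rplus g).
Proof.
have spec0 : ~ spectrum A 0.
  rewrite A_spectrum => -[k _ /complexI/eqP].
  by rewrite expf_eq0 /= gt_eqF.
have [M M0 lM] := eigenvalue_inv_bounded H_hilbert lambda_gt0 psi_basis psi_eigen spec0.
have [s alpha_s] := alpha_L1.
have [N [mN N0 HN]] := step_approx_null alpha_s.
have mRp : measurable (Rplus : set (measurableTypeR R)) by exact: measurable_itv.
split; [|split; [|split]].
- move=> t Rt g.
  have t0 : 0 <= t by move: Rt; rewrite /Rplus /= in_itv/= andbT.
  have gu : is_bochner_integral `[t, +oo[ g (u t).
    exact: (wave_bochner H_hilbert A_self_adjoint lambda_gt0 psi_basis psi_eigen
      u_solves u_lim ut_lim alpha_s mN N0 HN M0 lM t0).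
  split; first by have [s' gs' _] := gu; exists s'.
  have mt : measurable (`[t, +oo[%classic : set (measurableTypeR R)).
    exact: measurable_itv.
  by rewrite (bochner_integralE mt (hilbert_functionals_separate H_hilbert) gu).
- move=> g.
  have gu : is_bochner_integral Rplus g (- u 0).
    exact: (wave_bochner0 H_hilbert A_self_adjoint lambda_gt0 psi_basis psi_eigen
      u_solves u_lim ut_lim alpha_s mN N0 HN M0 lM).
  split; first by have [s' gs' _] := gu; exists s'.
  by rewrite (bochner_integralE mRp (hilbert_functionals_separate H_hilbert) gu) opprK.
- exact: (cvg_fourier H_hilbert psi_basis).
- move=> k g.
  have gu : is_bochner_integral Rplus g (- ((lambda k)%:C * dot (u 0) (psi k))).
    exact: (wave_bochner_coef0 H_hilbert A_self_adjoint lambda_gt0 psi_basis psi_eigen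
      u_solves u_lim ut_lim alpha_s mN N0 HN M0 lM).
  split; first by have [s' gs' _] := gu; exists s'.
  rewrite (bochner_integralE mRp complex_functionals_separate gu).
  by rewrite mulrNN mulrA -rmorphM mulVf ?mul1r// gt_eqF.
Qed.
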